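(* For every $k\in\mathbb{N}$, the $4$-braid $\beta_k=\Delta^2\sigma_3^{-k}\in B_4$ satisfies $\psi'(\beta_k)\neq0$.
   Context: $B_4$ has generators $\sigma_1,\sigma_2,\sigma_3$, and $\Delta^2=(\sigma_1\sigma_2\sigma_3)^4$. $\psi'(\beta)$ is the reduced version of Plamenevskaya's transverse invariant: in the reduced Khovanov complex over $\mathbb{Z}/2\mathbb{Z}$ of the closed braid diagram $\hat\beta$ with a marked point (the quotient of the Khovanov complex by the subcomplex of generators labelling the marked circle $v_-$, quantum grading shifted by $-1$), it is the homology class of the generator in the oriented resolution (the $0$-resolution at positive crossings, the $1$-resolution at negative crossings) labelling the marked circle $v_+$ and all other circles $v_-$. *)

(* Defs.v *)
From mathcomp Require Import all_boot.
Set Implicit Arguments. Unset Strict Implicit. Unset Printing Implicit Defensive.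

(* A braid word: a list of letters (i, e) meaning sigma_i^{+1} if e = true
   and sigma_i^{-1} if e = false (1 <= i <= n-1), read bottom to top. *)
Definition bword := seq (nat * bool).

Definition gen (w : bword) (c : 'I_(size w)) : nat := (nth (0, true) w c).1.
Definition sgn (w : bword) (c : 'I_(size w)) : bool := (nth (0, true) w c).2.

(* Closed braid diagram of w on n strands.  Crossing c (c < size w) involves
   strand positions (gen c).-1 and gen c (0-based).  A node (l, p) is the arc
   of the diagram at strand position p just below crossing l (equivalently
   just above crossing l-1, cyclically: the braid closure).
   A resolution s assigns 0 (false) or 1 (true) to each crossing; the
   smoothing at c is the oriented ("vertical") one iff s c != sgn c, i.e.
   the 0-resolution at positive and the 1-resolution at negative crossings. *)
Definition local_edge (n : nat) (w : bword) (s : {ffun 'I_(size w) -> bool})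
    (c : 'I_(size w)) (x y : 'I_(size w) * 'I_n) : bool :=
  let j := gen c in
  let vert := s c != sgn c in
  [|| [&& x.1 == c, y.1 == ordS c, (x.2 : nat) == y.2,
          (x.2 : nat) != j.-1 & (x.2 : nat) != j],
      [&& vert, x.1 == c, y.1 == ordS c & (x.2 : nat) == y.2]
    | [&& ~~ vert,
          ((x.1 == c) && (y.1 == c)) || ((x.1 == ordS c) && (y.1 == ordS c)),
          (x.2 : nat) == j.-1 & (y.2 : nat) == j]].

Definition adj (n : nat) (w : bword) (s : {ffun 'I_(size w) -> bool}) :
    rel ('I_(size w) * 'I_n) :=
  fun x y => [exists c, local_edge s c x y || local_edge s c y x].

(* circles of the resolution s = connected components of connect (adj s) *)

Definition incident (n : nat) (w : bword) (c : 'I_(size w))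
    (x : 'I_(size w) * 'I_n) : bool :=
  ((x.1 == c) || (x.1 == ordS c)) &&
  (((x.2 : nat) == (gen c).-1) || ((x.2 : nat) == gen c)).

(* enhanced states: a resolution together with a labelling of nodes
   (true = v_+, false = v_-) which must be constant on circles *)
Definition state (n : nat) (w : bword) : finType :=
  ({ffun 'I_(size w) -> bool} * {ffun 'I_(size w) * 'I_n -> bool})%type.

Definition valid (n : nat) (w : bword) (st : state n w) : bool :=
  [forall x, forall y, connect (adj st.1) x y ==> (st.2 x == st.2 y)].

(* coefficient (in Z/2) of st' in the Khovanov differential of st:
   st'.1 is st.1 with one 0 changed to a 1 at crossing c, labels agree on all
   circles not touching c, and the local merge/split rule
   m: ++ -> +, +- -> -, -+ -> -, -- -> 0 ;  Delta: + -> +- + -+, - -> -- holds *)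
Definition dcoef (n : nat) (w : bword) (st st' : state n w) : bool :=
  [exists c,
    [&& ~~ st.1 c, st'.1 c,
        [forall c', (c' != c) ==> (st'.1 c' == st.1 c')],
        [forall x, ~~ [exists z : 'I_(size w) * 'I_n, incident c z && connect (adj st.1) x z]
                     ==> (st'.2 x == st.2 x)] &
        (let merge := ~~ [forall z1 : 'I_(size w) * 'I_n, forall z2 : 'I_(size w) * 'I_n,
                           incident c z1 && incident c z2 ==>
                           connect (adj st.1) z1 z2] in
         let allS := [forall z : 'I_(size w) * 'I_n, incident c z ==> st.2 z] in
         let hasS := [exists z : 'I_(size w) * 'I_n, incident c z && st.2 z] in
         let allS' := [forall z : 'I_(size w) * 'I_n, incident c z ==> st'.2 z] in
         let hasS' := [exists z : 'I_(size w) * 'I_n, incident c z && st'.2 z] in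
         if merge then hasS && (allS' == allS)
         else if allS then hasS' && ~~ allS' else ~~ hasS')]].

(* Reduced complex w.r.t. the marked point (node) mk: quotient of the
   Khovanov complex by the subcomplex spanned by states labelling the marked
   circle v_-.  Its basis: valid states labelling the marked circle v_+.
   Chains over Z/2 are finite sets of basis states. *)
Definition red_gen (n : nat) (w : bword) (mk : 'I_(size w) * 'I_n)
    (st : state n w) : bool := valid st && st.2 mk.

Definition dred (n : nat) (w : bword) (mk : 'I_(size w) * 'I_n)
    (X : {set state n w}) : {set state n w} :=
  [set y | red_gen mk y &&
           odd #|[set x in X | red_gen mk x && dcoef x y]| ].

(* oriented resolution, marked circle v_+, all other circles v_- *)
Definition psi_state (n : nat) (w : bword) (mk : 'I_(size w) * 'I_n) :
    state n w :=
  let s0 := [ffun c => ~~ sgn c] in (s0, [ffun x => connect (adj s0) mk x]).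

Definition psi_red_nonzero (n : nat) (w : bword) (mk : 'I_(size w) * 'I_n)
    : Prop :=
  dred mk [set psi_state mk] = set0 /\
  ~ (exists X : {set state n w}, dred mk X = [set psi_state mk]).

Definition Delta2_B4 : bword := flatten (nseq 4 [:: (1, true); (2, true); (3, true)]).
Definition beta (k : nat) : bword := Delta2_B4 ++ nseq k (3, false).

(* Main.v *)
(* A class is nonzero once some cocycle takes the value 1 on it.  Lowering the
   label of the marked circle identifies the reduced complex with a subcomplex
   of the unreduced one and sends psi' to the oriented state with all labels
   v_-, so a single cocycle of the unreduced complex deals with every marked
   point.

   Let m be the number of negative crossings that are resolved horizontally.
   For m > 0 the two rightmost strands of the tail break up into a cap, a cup
   and m - 1 small circles.  The cocycle is supported on states all of whose
   small circles are labelled v_-, that have m positive crossings in the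
   1-resolution, all among the crossings 1, 2, 5, 7, 10, and whose remaining
   labels lie in an explicit list of sixteen states, independent of k.  On
   the boundary of a state with a small circle labelled v_+ the two ways to
   absorb that circle cancel; if all small circles are labelled v_-, only the
   positive crossings and the first and last horizontal smoothings contribute,
   and closedness is a finite computation. *)
Require Import Defs.
From mathcomp Require Import all_boot fingroup perm zify.
Set Implicit Arguments. Unset Strict Implicit. Unset Printing Implicit Defensive.

(** * Surgery on resolutions *)

Section Resolutions.
Variables (n : nat) (w : bword).
Hypothesis gen_lt : forall c : 'I_(size w), 0 < gen c < n.
Notation node := ('I_(size w) * 'I_n)%type.
Notation resolution := {ffun 'I_(size w) -> bool}.
Implicit Types (s : resolution) (c : 'I_(size w)) (x y : node).

Lemma adj_sym s : symmetric (@adj n w s).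
Proof. by move=> x y; apply: eq_existsb => c; rewrite orbC. Qed.

Lemma connect_adj_sym s : connect_sym (@adj n w s).
Proof. by apply: sym_connect_sym; apply: adj_sym. Qed.

(** * Circles as the cycles of a permutation of the nodes *)

Definition mate (c : 'I_(size w)) (p : 'I_n) : 'I_n :=
  insubd p (if p == (gen c).-1 :> nat then gen c else (gen c).-1).

Definition at_crossing (c : 'I_(size w)) (p : 'I_n) : bool :=
  (p == (gen c).-1 :> nat) || (p == gen c :> nat).

Lemma val_mate c p :
  val (mate c p) = if p == (gen c).-1 :> nat then gen c else (gen c).-1.
Proof. by rewrite val_insubd; have := gen_lt c; case: eqP; case: ifP; lia. Qed.

Lemma at_crossing_mate c p : at_crossing c (mate c p).
Proof. by rewrite /at_crossing val_mate; case: ifP; rewrite eqxx ?orbT. Qed.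

Lemma mateK c p : at_crossing c p -> mate c (mate c p) = p.
Proof.
move=> h; apply/val_inj; rewrite !val_mate; move: h; rewrite /at_crossing.
by have := gen_lt c; do ![case: eqP => //=]; lia.
Qed.

(** The two positions at a crossing are consecutive. This change of parity is what lets horizontal
    smoothings respect an orientation of the strands by parity. *)
Lemma odd_mate c p : at_crossing c p -> odd (mate c p) = ~~ odd p.
Proof.
rewrite /at_crossing val_mate; have := gen_lt c.
case: (gen c) => [|j] //= _; case: eqP => [-> //|_ /= /eqP ->].
by rewrite /= negbK.
Qed.

(* Orient the circles so that strands in even position run upwards and those
   in odd position downwards: both smoothings of a crossing respect this. *)
Definition step s (up : bool) x : node :=
  let c := if up then x.1 else ord_pred x.1 in
  if (s c == sgn c) && at_crossing c x.2 then (x.1, mate c x.2)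
  else (if up then ordS x.1 else ord_pred x.1, x.2).

Definition next s x := step s (~~ odd x.2) x.

(** The inverse follows every strand against its orientation: it is [step] with the opposite
    direction. *)
Lemma next_inj s : injective (next s).
Proof.
apply: (can_inj (g := fun x => step s (odd x.2) x)) => -[l p].
rewrite /next /step /=.
case: (boolP (odd p)) => odd_p /=.
  case: (boolP ((s (ord_pred l) == sgn (ord_pred l)) && at_crossing (ord_pred l) p)) => h /=.
    by case/andP: h => h1 h2; rewrite odd_mate // odd_p /= h1 at_crossing_mate /= mateK.
  by rewrite odd_p (negbTE h) ord_predK.
case: (boolP ((s l == sgn l) && at_crossing l p)) => h /=.
  by case/andP: h => h1 h2; rewrite odd_mate // odd_p /= h1 at_crossing_mate /= mateK.
by rewrite (negbTE odd_p) ordSK (negbTE h).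
Qed.

Definition next_perm s : {perm node} := perm (@next_inj s).

Lemma at_crossing_gen c (p q : 'I_n) :
  p = (gen c).-1 :> nat -> q = gen c :> nat ->
  [/\ at_crossing c p, at_crossing c q, mate c p = q & mate c q = p].
Proof.
move=> hp hq; rewrite /at_crossing hp hq !eqxx orbT; split=> //.
  by apply/val_inj; rewrite val_mate /= hp hq eqxx.
by apply/val_inj; rewrite val_mate /= hp hq; have := gen_lt c; case: eqP; lia.
Qed.

Lemma local_edge_next s c x y :
  local_edge s c x y -> y = next s x \/ x = next s y.
Proof.
case: x y => [l p] [l' p']; rewrite /local_edge /= /next /step /=.
have [v|v] := boolP (s c != sgn c).
  rewrite /= orbF => h; have {h} [-> -> ->] : [/\ l = c, l' = ordS c & p = p'].
    by case/orP: h => [/and5P[/eqP-> /eqP-> /eqP/val_inj->]|/and3P[/eqP-> /eqP-> /eqP/val_inj->]].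
  case: (boolP (odd p')) => _ /=; [right | left]; rewrite ?ordSK ?(negbTE v) //.
rewrite /=; case/orP => [/and5P[/eqP-> /eqP-> /eqP/val_inj-> h1 h2]|].
  have h : at_crossing c p' = false by apply/negbTE; rewrite negb_or h1.
  by case: (boolP (odd p')) => _ /=; [right | left]; rewrite ?ordSK h andbF.
move: v; rewrite negbK => v.
case/and3P=> h /eqP hp /eqP hq; have [h1 h2 h3 h4] := at_crossing_gen hp hq.
have := odd_mate h1; rewrite h3.
case/orP: h => /andP[/eqP-> /eqP->] ->; case: (boolP (odd p)) => _ /=.
- by right; rewrite v h2 h4.
- by left; rewrite v h1 h3.
- by left; rewrite ordSK v h1 h3.
- by right; rewrite ordSK v h2 h4.
Qed.

Lemma adj_next s x : adj s x (next s x).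
Proof.
case: x => l p; rewrite /next /step /=; apply/existsP.
exists (if ~~ odd p then l else ord_pred l).
have ne c : (gen c == (gen c).-1) = false by apply/eqP; have := gen_lt c; lia.
case: (boolP (odd p)) => /= odd_p; case: ifP => [/andP[v h]|h] /=;
  rewrite /local_edge /= ?v /= ?ord_predK ?eqxx /= ?orbT /=.
- by rewrite val_mate; case/orP: h => /eqP e; rewrite e ?eqxx ?ne ?eqxx ?orbT.
- by case/nandP: (negbT h) => [->|]; rewrite ?negb_or ?andbT ?orbT // => ->; rewrite ?orbT.
- by rewrite val_mate; case/orP: h => /eqP e; rewrite e ?eqxx ?ne ?eqxx ?orbT.
- by case/nandP: (negbT h) => [->|]; rewrite ?negb_or ?andbT ?orbT // => ->; rewrite ?orbT.
Qed.

(** Each edge is traversed by [next] in one direction or the other. Circles thus become cycles of a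
    permutation, to which cycle counting applies. *)
Lemma connect_porbit s x y : connect (adj s) x y = (y \in porbit (next_perm s) x).
Proof.
apply/idP/idP => [/connectP[q]|].
  elim: q x => [|z q IHq] x /=; first by move=> _ ->; apply: porbit_id.
  case/andP=> /existsP[c xz] /IHq h /h {h}; rewrite -!eq_porbit_mem => /eqP->.
  have /orP : (z == next s x) || (x == next s z).
    by case/orP: xz => /local_edge_next[] <-; rewrite eqxx ?orbT.
  rewrite eq_porbit_mem => -[] /eqP h.
    by rewrite h -[next s x](permE (@next_inj s)) (mem_porbit _ 1).
  by rewrite porbit_sym h -[next s z](permE (@next_inj s)) (mem_porbit _ 1).
case/porbitP=> i ->; elim: i => [|i IHi]; first by rewrite expg0 perm1 connect0.
apply: connect_trans IHi _; rewrite expgSr permM permE.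
by apply: connect1; apply: adj_next.
Qed.

(** * Changing the resolution at one crossing *)

Definition flip s c : resolution := [ffun c' => if c' == c then ~~ s c else s c'].

Lemma flipE s c c' : flip s c c' = if c' == c then ~~ s c else s c'.
Proof. by rewrite ffunE. Qed.

Lemma flipK s c : flip (flip s c) c = s.
Proof. by apply/ffunP=> c'; rewrite !flipE eqxx negbK; case: eqP => [->|]. Qed.

Definition lower_pos c : 'I_n := insubd (Ordinal (proj2 (andP (gen_lt c)))) (gen c).-1.
Definition upper_pos c : 'I_n := Ordinal (proj2 (andP (gen_lt c))).

Lemma val_lower_pos c : val (lower_pos c) = (gen c).-1.
Proof. by rewrite val_insubd; have := gen_lt c; case: ifP; lia. Qed.

(** Sorting the two positions by parity rather than by height fixes the directions: upwards on the
    even one, downwards on the odd one. *)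
Definition even_pos c := if odd (gen c) then lower_pos c else upper_pos c.
Definition odd_pos c := if odd (gen c) then upper_pos c else lower_pos c.

Lemma at_crossingE c p : at_crossing c p = (p == even_pos c) || (p == odd_pos c).
Proof.
by rewrite /even_pos /odd_pos; case: ifP => _; rewrite -!val_eqE /= val_lower_pos // orbC.
Qed.

Lemma parity_pos c : ~~ odd (even_pos c) /\ odd (odd_pos c).
Proof.
rewrite /even_pos /odd_pos; have := gen_lt c.
by case: ifP => /= odd_c; rewrite !val_lower_pos ?odd_c //=; case: (gen c) odd_c => //= j /negbFE->.
Qed.

Lemma mate_pos c : mate c (even_pos c) = odd_pos c /\ mate c (odd_pos c) = even_pos c.
Proof.
have [_ _ h1 h2] := @at_crossing_gen c (lower_pos c) (upper_pos c) (val_lower_pos c) erefl.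
by rewrite /even_pos /odd_pos; case: ifP.
Qed.

(* [next] enters crossing [c] at the nodes [in_*] and leaves it at [out_*]. *)
Definition in_up c : node := (c, even_pos c).
Definition in_down c : node := (ordS c, odd_pos c).
Definition out_up c : node := (ordS c, even_pos c).
Definition out_down c : node := (c, odd_pos c).

Lemma incidentE c x :
  incident c x = [|| x == in_up c, x == in_down c, x == out_up c | x == out_down c].
Proof.
rewrite /incident -/(at_crossing c x.2) at_crossingE.
case: x => l p; rewrite /= !xpair_eqE.
by case: (l == c); case: (l == ordS c); case: (p == even_pos c); case: (p == odd_pos c).
Qed.

Lemma next_in s c :
  next s (in_up c) = (if s c == sgn c then out_down c else out_up c) /\
  next s (in_down c) = (if s c == sgn c then out_up c else out_down c).
Proof.
have [h1 h2] := parity_pos c; have [h3 h4] := mate_pos c.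
rewrite /next /step /= h1 h2 /= ordSK !at_crossingE !eqxx orbT h3 h4 !andbT.
by split; case: eqP.
Qed.

Lemma next_other s c x : x != in_up c -> x != in_down c ->
  next (flip s c) x = next s x.
Proof.
case: x => l p /=; rewrite /in_up /in_down !xpair_eqE /next /step /=.
case: (boolP (odd p)) => odd_p /=; rewrite !flipE => h1 h2.
  have [e|//] := eqVneq (ord_pred l) c; move: h2; rewrite -e ord_predK eqxx /= => h2.
  rewrite at_crossingE (negbTE h2) orbF.
  suff /negbTE-> : p != even_pos (ord_pred l) by rewrite !andbF.
  by apply: contraTneq odd_p => ->; case: (parity_pos (ord_pred l)).
have [e|//] := eqVneq l c; move: h1; rewrite e eqxx /= => h1.
rewrite at_crossingE (negbTE h1) /=.
suff /negbTE-> : p != odd_pos c by rewrite !andbF.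
by apply: contraNneq odd_p => ->; case: (parity_pos c).
Qed.

Lemma in_up_neq_down c : in_up c != in_down c.
Proof.
rewrite xpair_eqE; apply/nandP; right; have [h1 h2] := parity_pos c.
by apply: contraNneq h1 => ->.
Qed.

(** Both smoothings join the two incoming ends to the two outgoing ends, with opposite pairings. *)
Lemma next_perm_flip s c :
  next_perm (flip s c) = (tperm (in_up c) (in_down c) * next_perm s)%g.
Proof.
apply/permP=> x; rewrite permM [LHS]permE [RHS]permE; have [h1 h2] := next_in s c.
have [h3 h4] := next_in (flip s c) c; rewrite flipE eqxx in h3 h4.
have hs : (~~ s c == sgn c) = ~~ (s c == sgn c) by case: (s c); case: (sgn c).
rewrite hs in h3 h4.
case: tpermP => [->|->|/eqP h5 /eqP h6]; last exact: next_other.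
  by rewrite h2 h3; case: (s c == _).
by rewrite h1 h4; case: (s c == _).
Qed.

(* Surgery at a crossing either merges two circles or splits one. *)
Lemma flip_connect s c :
  connect (adj (flip s c)) (in_up c) (in_down c) =
  ~~ connect (adj s) (in_up c) (in_down c).
Proof.
rewrite !connect_porbit ![in_down c \in _]porbit_sym.
(* Multiplying by a transposition changes the number of cycles by one, upwards exactly when both
   points lie on one cycle. Going from [s] to its flip and back, exactly one of the two steps goes
   up. *)
have /= h1 := porbits_mul_tperm (next_perm s) (in_up c) (in_down c).
have /= h2 := porbits_mul_tperm (next_perm (flip s c)) (in_up c) (in_down c).
rewrite -next_perm_flip in h1; rewrite -next_perm_flip flipK in h2.
rewrite in_up_neq_down in h1 h2.
by move: h1 h2; do 2!case: (_ \in _) => /=; lia.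
Qed.

(** Each outgoing end is the successor of an incoming one, so the two incoming ends represent all
    circles at the crossing. *)
Lemma incident_connect s c x : incident c x ->
  connect (adj s) (in_up c) x || connect (adj s) (in_down c) x.
Proof.
rewrite incidentE; have [h1 h2] := next_in s c.
have h3 := connect1 (adj_next s (in_up c)); have h4 := connect1 (adj_next s (in_down c)).
move: h3 h4; rewrite h1 h2.
by case: (s c == sgn c) => h3 h4 /or4P[] /eqP->; rewrite ?connect0 ?h3 ?h4 ?orbT.
Qed.

Lemma incident_in c : incident c (in_up c) /\ incident c (in_down c).
Proof. by rewrite !incidentE !eqxx ?orbT. Qed.

Lemma all_incident_connect s c :
  [forall z1 : node, forall z2 : node, incident c z1 && incident c z2 ==>
      connect (adj s) z1 z2] = connect (adj s) (in_up c) (in_down c).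
Proof.
have [i1 i2] := incident_in c.
apply/idP/idP => [/forallP/(_ (in_up c))/forallP/(_ (in_down c))|h].
  by rewrite i1 i2.
apply/forallP=> z1; apply/forallP=> z2; apply/implyP=> /andP[j1 j2].
have aux z : incident c z -> connect (adj s) (in_up c) z.
  by case/(incident_connect s)/orP=> // /(connect_trans h).
by apply: connect_trans (aux _ j2); rewrite connect_adj_sym aux.
Qed.

(** An edge at [c] that starts away from the crossing is a straight strand, present in both
    resolutions. *)
Lemma adj_flip s c x y : ~~ incident c x -> adj (flip s c) x y = adj s x y.
Proof.
rewrite /incident negb_and => hx; apply: eq_existsb => c'.
have [-> {c'}|ne] := eqVneq c' c; last by rewrite /local_edge flipE (negbTE ne).
rewrite /local_edge.
case: x y hx => [l p] [l' p'] /=; rewrite -/(at_crossing c p) => hx.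
rewrite /at_crossing in hx.
move: hx; case: (l == c); case: (l == ordS c); case: (l' == c); case: (l' == ordS c);
 rewrite //= ?andbF ?andbT ?orbF //=; case: (flip s c c); case: (s c); case: (sgn c); rewrite //=;
 (try case: (eqVneq (p:nat) p') => [->|_]); rewrite /= ?andbF ?andbT ?orbF //=;
 rewrite ?negb_or => /andP[/negbTE-> /negbTE->]; rewrite /= ?andbF ?andbT ?orbF //=.
Qed.


Definition touches s c x := [exists z : node, incident c z && connect (adj s) x z].

Lemma touches_connect s c x y : connect (adj s) x y -> touches s c x = touches s c y.
Proof.
move=> xy; apply: eq_existsb => z; congr (_ && _).
exact: (same_connect (@connect_adj_sym s)).
Qed.

Lemma connect_flip s c x y : ~~ touches s c x ->
  connect (adj (flip s c)) x y = connect (adj s) x y.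
Proof.
move=> x_far; have far_adj z : ~~ touches s c z ->
    adj (flip s c) z =1 adj s z.
  move=> z_far t; apply: adj_flip; apply: contra z_far => z_c.
  by apply/existsP; exists z; rewrite z_c connect0.
apply/connectP/connectP => -[p xp ->] {y}; exists p => //.
  elim: p x x_far xp => //= z p IHp x x_far /andP[xz zp].
  rewrite far_adj // in xz; rewrite xz IHp //.
  by rewrite -(touches_connect c (connect1 xz)).
elim: p x x_far xp => //= z p IHp x x_far /andP[xz zp].
rewrite far_adj // xz IHp //.
by rewrite -(touches_connect c (connect1 xz)).
Qed.

Lemma touches_flip s c x : touches (flip s c) c x = touches s c x.
Proof.
have aux t : ~~ touches t c x -> ~~ touches (flip t c) c x.
  move=> far; apply: contra (far) => /existsP[z /andP[z_c]].
  by rewrite connect_flip // => xz; apply/existsP; exists z; rewrite z_c.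
by apply/idP/idP; apply: contraTT => /aux; rewrite ?flipK.
Qed.

(** * Labellings of circles and the differential *)

Definition circle_constant s (X : node -> bool) :=
  forall x y, connect (adj s) x y -> X x = X y.

Lemma all_incident s c (X : node -> bool) : circle_constant s X ->
  [forall z : node, incident c z ==> X z] = X (in_up c) && X (in_down c).
Proof.
move=> constX; have [i1 i2] := incident_in c; apply/forallP/andP => [h|[h1 h2] z].
  by split; [move: (h (in_up c)) | move: (h (in_down c))]; rewrite ?i1 ?i2.
by apply/implyP=> /(incident_connect s)/orP[] /constX <-.
Qed.

Lemma has_incident s c (X : node -> bool) : circle_constant s X ->
  [exists z : node, incident c z && X z] = X (in_up c) || X (in_down c).
Proof.
move=> constX; have [i1 i2] := incident_in c; apply/existsP/orP => [[z]|[] h].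
- by case/andP=> /(incident_connect s)/orP[] /constX <-; [left | right].
- by exists (in_up c); rewrite i1.
- by exists (in_down c); rewrite i2.
Qed.

Lemma touchesE s c x :
  touches s c x = connect (adj s) x (in_up c) || connect (adj s) x (in_down c).
Proof.
rewrite /touches (@has_incident s) // => y z yz.
exact: (same_connect_r (@connect_adj_sym s)).
Qed.

(* The merge and split maps, in terms of the labels of the two strands that
   run through the crossing. *)
Definition surgery_rule (merge a b a' b' : bool) : bool :=
  if merge then (a || b) && ((a' && b') == (a && b))
  else if a && b then (a' || b') && ~~ (a' && b') else ~~ (a' || b').

Definition surgery s c (X Y : node -> bool) : bool :=
  [forall x, ~~ touches s c x ==> (Y x == X x)] &&
  surgery_rule (~~ connect (adj s) (in_up c) (in_down c))
    (X (in_up c)) (X (in_down c)) (Y (in_up c)) (Y (in_down c)).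

Lemma validP (st : state n w) : reflect (circle_constant st.1 st.2) (valid st).
Proof.
apply: (iffP forallP) => [h x y xy|h x]; last first.
  by apply/forallP=> y; apply/implyP=> /h->.
by have /forallP/(_ y)/implyP/(_ xy)/eqP := h x.
Qed.

Lemma flip_uniq s c c' : ~~ s c -> ~~ s c' -> flip s c = flip s c' -> c = c'.
Proof.
move=> /negbTE h /negbTE h' /ffunP/(_ c); rewrite !flipE eqxx h.
by case: eqP.
Qed.

(** At most one crossing turns [st.1] into [st'.1], so the existential in [dcoef] is also a sum over
    Z/2, which can be exchanged with other sums. *)
Lemma dcoef_surgery (st st' : state n w) : valid st -> valid st' ->
  dcoef st st' = \big[addb/false]_(c | ~~ st.1 c)
    ((st'.1 == flip st.1 c) && surgery st.1 c st.2 st'.2).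
Proof.
move=> /validP v /validP v'.
have E : dcoef st st' = [exists c, ~~ st.1 c &&
    ((st'.1 == flip st.1 c) && surgery st.1 c st.2 st'.2)].
  apply: eq_existsb => c; case: (boolP (st.1 c)) => //= s_c.
  rewrite andbA; have -> : st'.1 c && [forall c', (c' != c) ==> (st'.1 c' == st.1 c')]
     = (st'.1 == flip st.1 c).
    apply/andP/eqP => [[h /forallP h']|->]; last first.
      rewrite flipE eqxx; split=> //; apply/forallP=> c'; rewrite flipE.
      by case: (eqVneq c' c); rewrite /= ?eqxx.
    apply/ffunP=> c'; rewrite flipE; case: eqVneq => [->|ne].
      by rewrite h s_c.
    by move: (h' c'); rewrite ne /= => /eqP.
  case: eqP => //= e; rewrite /surgery /surgery_rule; congr (_ && _).
  rewrite all_incident_connect (all_incident _ v) (has_incident _ v).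
  by rewrite (all_incident _ v') (has_incident _ v').
rewrite E; case: existsP => [[c /andP[s_c h]]|h].
  rewrite (bigD1 c) //= h big1 ?addbF // => c' /andP[s_c' ne].
  apply/negbTE; apply: contra ne => /andP[/eqP e _].
  case/andP: h => /eqP; rewrite e => e' _; apply/eqP.
  exact: flip_uniq e'.
rewrite big1 // => c s_c; apply/negbTE/negP => h'; apply: h.
by exists c; rewrite s_c.
Qed.

Lemma dcoef_exists (x y : state n w) : valid x -> valid y -> dcoef x y ->
  exists2 c, ~~ x.1 c & y.1 = flip x.1 c /\ surgery x.1 c x.2 y.2.
Proof.
move=> vx vy; rewrite dcoef_surgery // => h.
have /existsP[c /and3P[x_c /eqP e sc]] : [exists c, ~~ x.1 c &&
    ((y.1 == flip x.1 c) && surgery x.1 c x.2 y.2)].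
  apply: contraTT h; rewrite negb_exists => /forallP h.
  by rewrite big1 // => c x_c; move: (h c); rewrite x_c => /negbTE.
by exists c.
Qed.

(** In the oriented resolution every smoothing is vertical, so a circle never leaves its strand
    position. *)
Lemma oriented_connect_pos (x y : node) :
  connect (adj [ffun c => ~~ sgn c]) x y -> x.2 = y.2.
Proof.
case/connectP=> p + ->; elim: p x => //= z p IHp x /andP[/existsP[c xz] /IHp <-].
have v : ([ffun c => ~~ sgn c] : resolution) c != sgn c by rewrite ffunE; case: (sgn c).
by move: xz; rewrite /local_edge v /= !orbF => /orP[] /orP[] /and3P[_ _];
  do ?case/andP; move=> /eqP/val_inj.
Qed.

(** * The marked circle and the reduced complex *)

Section Marked.
Variable mk : node.

Definition lower_label s (X : node -> bool) : node -> bool :=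
  fun x => X x && ~~ connect (adj s) mk x.

Lemma lower_constant s X : circle_constant s X -> circle_constant s (lower_label s X).
Proof.
move=> h x y xy; rewrite /lower_label (h _ _ xy).
by rewrite (same_connect_r (@connect_adj_sym s) xy).
Qed.

(** Modulo states with the marked circle at [v_-], a marked [v_+] survives a merge exactly when the
    other circle is [v_+], and a split leaves [v_-] on the other part. These are the unreduced rules
    for a marked circle labelled [v_-]. *)
Lemma surgery_lower s c (X Y : node -> bool) :
  circle_constant s X -> circle_constant (flip s c) Y -> X mk -> Y mk ->
  surgery s c (lower_label s X) (lower_label (flip s c) Y) = surgery s c X Y.
Proof.
move=> cX cY Xmk Ymk; rewrite /surgery; congr (_ && _).
  apply: eq_forallb => x; case: (boolP (touches s c x)) => //= x_far.
  rewrite /lower_label ![connect _ mk x]connect_adj_sym connect_flip //.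
  case: (boolP (connect _ x mk)) => [x_mk|_]; last by rewrite !andbT.
  by rewrite (cX _ _ x_mk) (cY x mk) ?connect_flip // Xmk Ymk.
have f := flip_connect s c.
have t1 := touchesE s c mk; have t2 := touchesE (flip s c) c mk.
rewrite touches_flip in t2.
(* [imp] and [tri] state as Boolean implications that the marked circle carries [v_+] and that
   connectedness is transitive; the claim then becomes a truth table. *)
have imp t Z z : circle_constant t Z -> Z mk -> connect (adj t) mk z ==> Z z.
  by move=> cZ Zmk; apply/implyP=> /cZ <-.
move: (imp _ _ (in_up c) cX Xmk) (imp _ _ (in_down c) cX Xmk).
move: (imp _ _ (in_up c) cY Ymk) (imp _ _ (in_down c) cY Ymk).
have tri t z z' : (connect (adj t) mk z ==> (connect (adj t) mk z' == connect (adj t) z z')).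
  by apply/implyP=> /(same_connect (@connect_adj_sym t)) ->.
move: t1 t2 (tri s (in_up c) (in_down c)) (tri s (in_down c) (in_up c)).
move: (tri (flip s c) (in_up c) (in_down c)) (tri (flip s c) (in_down c) (in_up c)).
rewrite !(@connect_adj_sym _ (in_down c) (in_up c)) {}f /lower_label.
case: (touches s c mk); case: (connect (adj s) mk (in_up c));
case: (connect (adj s) mk (in_down c));
case: (connect (adj (flip s c)) mk (in_up c));
case: (connect (adj (flip s c)) mk (in_down c));
case: (connect (adj s) (in_up c) (in_down c)) => //= _ _ _ _ _ _;
by case: (X (in_up c)); case: (X (in_down c)); case: (Y (in_up c)); case: (Y (in_down c)).
Qed.

(** A merge involving [v_-] gives [v_-] or zero, and splitting [v_-] gives two [v_-]. Hence the
    states with marked label [v_-] span a subcomplex. *)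
Lemma surgery_mark s c (X Y : node -> bool) :
  circle_constant s X -> circle_constant (flip s c) Y ->
  surgery s c X Y -> ~~ X mk -> ~~ Y mk.
Proof.
move=> cX cY /andP[/forallP/(_ mk) far near]; apply: contra => Ymk.
have := touchesE s c mk; have := touchesE (flip s c) c mk; rewrite touches_flip.
move: far; case: (touches s c mk) => /=; first last.
  by rewrite Ymk => /eqP <-.
move=> _; rewrite (connect_adj_sym s) (connect_adj_sym s).
have eqX := cX (in_up c) (in_down c); have eqY := cY (in_up c) (in_down c).
rewrite flip_connect in eqY.
move=> mkY mkX; have : (Y (in_up c) || Y (in_down c)) by case/esym/orP: mkY => /cY <-; rewrite Ymk ?orbT.
have : (X mk == X (in_up c)) || (X mk == X (in_down c)).
  by case/esym/orP: mkX => /cX <-; rewrite eqxx ?orbT.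
move: near eqX eqY; rewrite /surgery_rule.
case: (connect _ _ _) => /= near eqX eqY; last first.
  by move: near; rewrite (eqY isT); case: (X mk); case: (X _); case: (X _); case: (Y _).
by move: near; rewrite (eqX isT); case: (X mk); case: (X _); case: (Y _); case: (Y _).
Qed.

Definition lower (st : state n w) : state n w :=
  (st.1, [ffun x => lower_label st.1 st.2 x]).

Definition raise (st : state n w) : state n w :=
  (st.1, [ffun x => st.2 x || connect (adj st.1) mk x]).

Lemma lower_valid st : valid st -> valid (lower st).
Proof.
by move=> /validP/lower_constant h; apply/validP=> x y xy; rewrite !ffunE (h _ _ xy).
Qed.

Lemma raise_valid st : valid st -> valid (raise st).
Proof.
move=> /validP h; apply/validP=> x y xy; rewrite !ffunE (h _ _ xy).
by rewrite (same_connect_r (@connect_adj_sym st.1) xy).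
Qed.

Lemma lowerK st : valid st -> st.2 mk -> raise (lower st) = st.
Proof.
case: st => s X /validP /= cX Xmk; congr (_, _); apply/ffunP=> x; rewrite !ffunE /lower_label.
case: (boolP (connect _ mk x)) => [/cX <-|]; first by rewrite Xmk.
by rewrite andbT orbF.
Qed.

Lemma raiseK st : valid st -> ~~ st.2 mk -> lower (raise st) = st.
Proof.
case: st => s X /validP /= cX Xmk; congr (_, _); apply/ffunP=> x; rewrite !ffunE /lower_label.
rewrite ffunE; case: (boolP (connect _ mk x)) => [/cX <-|].
  by rewrite (negbTE Xmk) andbF.
by rewrite andbT orbF.
Qed.

Lemma dcoef_lower (x y : state n w) : red_gen mk x -> red_gen mk y ->
  dcoef (lower x) (lower y) = dcoef x y.
Proof.
move=> /andP[vx x_mk] /andP[vy y_mk].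
rewrite !dcoef_surgery ?lower_valid //=; apply: eq_bigr => c _.
case: eqP => //= e; rewrite -(@surgery_lower _ _ x.2 y.2) //.
- rewrite /surgery; congr (_ && _); last by rewrite !ffunE e.
  by apply: eq_forallb => z; rewrite !ffunE e.
- exact/validP.
- by rewrite -e; apply/validP.
Qed.

Lemma dcoef_mark (x y : state n w) : valid x -> valid y -> dcoef x y ->
  ~~ x.2 mk -> ~~ y.2 mk.
Proof.
move=> vx vy h x_mk; have [c _ [e sc]] := dcoef_exists vx vy h.
by apply: surgery_mark sc x_mk; [exact/validP | rewrite -e; exact/validP].
Qed.

(* A cocycle of the unreduced complex restricts to the subcomplex in which the
   marked circle is labelled v_-, which lowering the marked label identifies
   with the reduced complex. *)
Lemma psi_not_boundary (G : state n w -> bool) :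
  (forall x : state n w, valid x -> \big[addb/false]_(y | valid y) (dcoef x y && G y) = false) ->
  G ([ffun c => ~~ sgn c], [ffun=> false]) ->
  ~ exists X, dred mk X = [set psi_state mk].
Proof.
move=> dG Gpsi [X dX].
have redG (x : state n w) : red_gen mk x ->
    \big[addb/false]_(y | red_gen mk y) (dcoef x y && G (lower y)) = false.
  move=> rx; have /andP[vx x_mk] := rx.
  rewrite -[RHS](dG (lower x) (lower_valid vx)) [RHS](bigID (fun y : state n w => y.2 mk)) /=.
  (* No target of [lower x] labels the marked circle [v_+], because [lower x] labels it [v_-]. *)
  rewrite [X in _ = X (+) _]big1 ?addFb; last first.
    move=> y /andP[vy y_mk]; apply/negbTE; rewrite negb_and; apply/orP; left.
    apply: contraL y_mk => /dcoef_mark; apply=> //; first exact: lower_valid.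
    by rewrite ffunE /lower_label connect0 andbF.
  rewrite [RHS](reindex_onto lower raise) => [|y /andP[vy y_mk]]; last exact: raiseK.
  rewrite [LHS]big_mkcond [RHS]big_mkcond; apply: eq_bigr => y _.
  have -> : valid (lower y) && ~~ (lower y).2 mk && (raise (lower y) == y) = red_gen mk y.
    apply/idP/idP => [/andP[/andP[v _] /eqP <-]|/andP[v y_mk]].
      by rewrite /red_gen raise_valid // ffunE connect0 orbT.
    by rewrite lower_valid // lowerK // eqxx ffunE /lower_label connect0 andbF.
  by case: ifP => // ry; rewrite dcoef_lower.
have oddE (y : state n w) : odd #|[set x in X | red_gen mk x && dcoef x y]| =
    \big[addb/false]_(x in X | red_gen mk x) dcoef x y.
  rewrite -sum1_card (big_morph odd oddD (erefl (odd 0))).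
  rewrite big_mkcond [RHS]big_mkcond; apply: eq_bigr => z _; rewrite !inE /=.
  by case: (z \in X); case: (red_gen mk z); case: (dcoef z y).
(* Evaluating the cochain on the boundary of [X] and exchanging the sums gives zero, whereas on the
   single state [psi_state mk] it is the value of [G] on the all-[v_-] oriented state. *)
have : \big[addb/false]_(y in dred mk X) G (lower y) = false.
  transitivity (\big[addb/false]_(y | red_gen mk y) \big[addb/false]_(x in X | red_gen mk x)
     (dcoef x y && G (lower y))).
    rewrite big_mkcond [RHS]big_mkcond; apply: eq_bigr => y _; rewrite inE oddE.
    by case: (red_gen mk y) => //=; rewrite -big_distrl /=; case: ifP.
  by rewrite exchange_big big1 // => x /andP[_ rx]; apply: redG.
rewrite dX big_set1 /lower /psi_state /= => /negbT/negP; apply.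
have -> : [ffun x => lower_label [ffun c => ~~ sgn c] [ffun x => connect (adj [ffun c => ~~ sgn c]) mk x] x] = [ffun=> false] :> {ffun node -> bool}.
  by apply/ffunP=> x; rewrite !ffunE /lower_label ffunE andbN.
by [].
Qed.

(** Every flip of the oriented resolution merges two strands. Two labels [v_-] give zero, and the
    marked [v_+] merged with [v_-] gives a marked [v_-], which is zero in the quotient. *)
Lemma psi_cycle : dred mk [set psi_state mk] = set0.
Proof.
apply/setP=> y; rewrite !inE; apply/negbTE/negP => /andP[/andP[vy y_mk] odd_y].
have : #|[set x in [set psi_state mk] | red_gen mk x && dcoef x y]| != 0.
  by apply: contraTneq odd_y => ->.
rewrite -lt0n => /card_gt0P[x]; rewrite !inE => /and3P[/eqP-> {x odd_y} /andP[vx _]].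
case/(dcoef_exists vx vy) => c /= _ [e /andP[_]].
set s0 := [ffun c => ~~ sgn c] in e *; rewrite !ffunE.
have far : ~~ connect (adj s0) (in_up c) (in_down c).
  apply/negP => /oriented_connect_pos /= h; have [] := parity_pos c.
  by rewrite h => /negbTE->.
rewrite far /= => h; have := flip_connect s0 c; rewrite far -e => near.
have cY := validP _ vy; have tri := same_connect (@connect_adj_sym s0).
have := touchesE s0 c mk; rewrite -touches_flip -e touchesE => t.
move: h t; rewrite (cY _ _ near) andbb orbC.
have -> : connect (adj s0) mk (in_up c) && connect (adj s0) mk (in_down c) = false.
  by apply/negbTE; apply: contra far => /andP[/tri ->].
case/andP=> + /eqP Y0; rewrite orbC => -> /orP[] /cY; rewrite y_mk ?Y0 //.
by rewrite (cY _ _ near) Y0.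
Qed.

End Marked.

End Resolutions.

(** * Circles of the resolutions of beta_k *)

(** Components are computed on plain lists of numbers so that the final check runs by evaluation.
    Each edge renames one representative throughout the list. *)
Definition union_find (E : seq (nat * nat)) (r : seq nat) : seq nat :=
  foldl (fun r e => [seq (if a == nth 0 r e.1 then nth 0 r e.2 else a) | a <- r]) r E.

Lemma union_find_eq E r u v : u < size r -> v < size r ->
  nth 0 r u = nth 0 r v -> nth 0 (union_find E r) u = nth 0 (union_find E r) v.
Proof.
elim: E r => //= e E IHE r ur vr h; apply: IHE; rewrite ?size_map //.
by rewrite !(nth_map 0) ?h.
Qed.

Lemma union_find_edge E r e : e \in E -> e.1 < size r -> e.2 < size r ->
  nth 0 (union_find E r) e.1 = nth 0 (union_find E r) e.2.
Proof.
elim: E r => //= e' E IHE r; rewrite inE => /predU1P[->|eE] h1 h2; last first.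
  by apply: IHE; rewrite ?size_map.
apply: union_find_eq; rewrite ?size_map // !(nth_map 0) // eqxx.
by case: ifP.
Qed.

(** Soundness: renaming along an edge stays within a class of [R]. With [union_find_edge] it follows
    that equal representatives mean the same component. *)
Lemma union_find_class (R : nat -> nat -> Prop) E r :
  (forall i j, R i j -> R j i) -> (forall i j h, R i j -> R j h -> R i h) ->
  (forall e, e \in E -> [/\ e.1 < size r, e.2 < size r & R e.1 e.2]) ->
  (forall i, i < size r -> R i (nth 0 r i) /\ nth 0 r i < size r) ->
  forall i, i < size r ->
    R i (nth 0 (union_find E r) i) /\ nth 0 (union_find E r) i < size r.
Proof.
move=> Rs Rt; elim: E r => //= e E IHE r hE hr i ir.
have [h1 h2 h3] := hE e (mem_head _ _).
set r' := map _ r; have sz : size r' = size r by rewrite size_map.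
rewrite -sz; apply: IHE; rewrite sz //.
  by move=> f fE; apply: hE; rewrite inE fE orbT.
move=> j jr; rewrite (nth_map 0) //; case: eqP => [e'|_]; last exact: hr.
have [a1 _] := hr _ jr; have [a2 _] := hr _ h1; have [a3 ?] := hr _ h2.
by split=> //; apply: (Rt _ _ _ a1); rewrite e'; apply: (Rt _ _ _ (Rs _ _ a2) (Rt _ _ _ h3 a3)).
Qed.

(* The node (l, p) with l <= 12 is numbered 4 l + p.  The last four edges are
   the closure of the braid through the tail, where the two rightmost strands
   are capped off on either side. *)
Definition level_edges (b : seq bool) (l : nat) : seq (nat * nat) :=
  [seq (4 * l + p, 4 * l + 4 + p) | p <- iota 0 4 &
     ~~ nth false b l || (p != l %% 3) && (p != (l %% 3).+1)] ++
  if nth false b l then [:: (4 * l + l %% 3, 4 * l + (l %% 3).+1);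
                            (4 * l + 4 + l %% 3, 4 * l + 4 + (l %% 3).+1)]
  else [::].

Definition closure_edges : seq (nat * nat) := [:: (48, 0); (49, 1); (50, 51); (2, 3)].

Definition core_edges (b : seq bool) : seq (nat * nat) :=
  flatten [seq level_edges b l | l <- iota 0 12] ++ closure_edges.

Definition reps (b : seq bool) : seq nat := union_find (core_edges b) (iota 0 52).
Notation rep b i := (nth 0 (reps b) i).

Lemma mem_core_edges b e : reflect
  ((exists l p, [/\ l < 12, p < 4,
      ~~ nth false b l || (p != l %% 3) && (p != (l %% 3).+1) &
      e = (4 * l + p, 4 * l + 4 + p)]) \/
   (exists l, [/\ l < 12, nth false b l &
      e = (4 * l + l %% 3, 4 * l + (l %% 3).+1) \/
      e = (4 * l + 4 + l %% 3, 4 * l + 4 + (l %% 3).+1)]) \/ e \in closure_edges)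
  (e \in core_edges b).
Proof.
rewrite mem_cat; apply: (iffP orP) => [[/flatten_mapP[l]|]|].
- rewrite mem_iota mem_cat => l12 /orP[/mapP[p]|].
    by rewrite mem_filter mem_iota => /andP[h p4] ->; left; exists l, p.
  case: ifP => // bl; rewrite !inE => /orP h; right; left; exists l; split=> //.
  by case: h => /eqP->; [left | right].
- by move=> h; right; right.
case=> [[l [p [l12 p4 h ->]]]|[[l [l12 bl h]]|h]]; last by right.
  left; apply/flatten_mapP; exists l; first by rewrite mem_iota.
  by rewrite mem_cat; apply/orP; left; apply/mapP; exists p; rewrite ?mem_filter ?mem_iota ?h.
left; apply/flatten_mapP; exists l; first by rewrite mem_iota.
by rewrite mem_cat bl !inE; case: h => ->; rewrite eqxx ?orbT.
Qed.

Lemma core_edges_lt b e : e \in core_edges b -> e.1 < 52 /\ e.2 < 52.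
Proof.
case/mem_core_edges=> [[l [p [l12 p4 h ->]]]|[[l [l12 bl [] ->]]|]] /=; try lia.
by rewrite !inE => /or4P[] /eqP->.
Qed.

Lemma rep_edge b e : e \in core_edges b -> rep b e.1 = rep b e.2.
Proof. by move=> h; have [h1 h2] := core_edges_lt h; apply: union_find_edge; rewrite ?size_iota. Qed.

Lemma rep_class (R : nat -> nat -> Prop) b :
  (forall i, R i i) -> (forall i j, R i j -> R j i) ->
  (forall i j h, R i j -> R j h -> R i h) ->
  (forall e, e \in core_edges b -> R e.1 e.2) ->
  forall i, i < 52 -> R i (rep b i) /\ rep b i < 52.
Proof.
move=> R0 Rs Rt Re i i52.
have -> : 52 = size (iota 0 52) by []; apply: union_find_class; rewrite ?size_iota //.
  by move=> e eE; have [? ?] := core_edges_lt eE; split=> //; apply: Re.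
by move=> j j52; rewrite nth_iota.
Qed.

Lemma rep_lt b i : i < 52 -> rep b i < 52.
Proof. by move=> i52; have [] := @rep_class (fun _ _ => True) b _ _ _ _ i i52. Qed.

Lemma rep_closure b : [/\ rep b 48 = rep b 0, rep b 49 = rep b 1,
  rep b 51 = rep b 50 & rep b 3 = rep b 2].
Proof.
have h e : e \in closure_edges -> rep b e.1 = rep b e.2.
  by move=> h; apply: rep_edge; rewrite mem_cat h orbT.
by split; [apply: (h (48, 0)) | apply: (h (49, 1)) | symmetry; apply: (h (50, 51))
          | symmetry; apply: (h (2, 3))].
Qed.

(** * Numbering the circles of a resolution of [beta k] by colours *)

Section Circles.
Variable k : nat.
Notation N := (size (beta k)).
Notation node := ('I_N * 'I_4)%type.
Notation resolution := {ffun 'I_N -> bool}.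
Implicit Types (s : resolution) (c : 'I_N) (l p : nat).

Lemma size_beta : N = 12 + k.
Proof. by rewrite size_cat size_nseq. Qed.

Lemma size_beta_gt0 : 0 < N.
Proof. by rewrite size_beta. Qed.

Definition gen_at l := if l < 12 then (l %% 3).+1 else 3.

Lemma nth_beta l : l < N -> nth (0, true) (beta k) l = (gen_at l, l < 12).
Proof.
rewrite size_beta /beta /gen_at nth_cat (_ : size Delta2_B4 = 12) // => lN.
case: ltnP => l12.
  have /allP/(_ l) : all (fun i => nth (0, true) Delta2_B4 i == ((i %% 3).+1, true)) (iota 0 12) by [].
  by rewrite mem_iota => /(_ l12)/eqP.
by rewrite nth_nseq; case: ltnP => //; lia.
Qed.

Lemma gen_beta c : gen c = gen_at c.
Proof. by rewrite /gen nth_beta. Qed.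

Lemma sgn_beta c : sgn c = (c < 12).
Proof. by rewrite /sgn nth_beta. Qed.

Lemma gen_beta_lt c : 0 < gen c < 4.
Proof. by rewrite gen_beta /gen_at; case: ifP => _ //; lia. Qed.

Definition bit s l : bool := if insub l is Some c then s c else false.

Lemma bitE s c : bit s c = s c.
Proof. by rewrite /bit valK. Qed.

Definition vert s l : bool := bit s l != (l < 12).

(* Level N is level 0, by the closure of the braid. *)
Definition nd l p : node :=
  (Ordinal (ltn_pmod l size_beta_gt0), Ordinal (ltn_pmod p (isT : 0 < 4))).

Lemma nd_node (x : node) : nd x.1 x.2 = x.
Proof. by case: x => c p; congr (_, _); apply/val_inj; rewrite /= modn_small. Qed.

Lemma nd_ord c (p : 'I_4) : nd c p = (c, p).
Proof. exact: (nd_node (c, p)). Qed.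

Lemma nd_ordS c (p : 'I_4) : nd c.+1 p = (ordS c, p).
Proof. by congr (_, _); apply/val_inj; rewrite //= modn_small. Qed.

Lemma adj_vert s l p : l < N -> p < 4 ->
  (p != (gen_at l).-1) && (p != gen_at l) || vert s l -> adj s (nd l p) (nd l.+1 p).
Proof.
move=> lN p4 h; pose c := Ordinal lN; apply/existsP; exists c.
have e : nd l p = (c, (nd l p).2) by congr (_, _); apply/val_inj; rewrite /= modn_small.
rewrite /local_edge e /= gen_beta sgn_beta -bitE -/(vert s c) !eqxx /=.
rewrite -!val_eqE /= eqxx modn_small //.
by case/orP: h => ->; rewrite ?orbT.
Qed.

Lemma adj_horiz s l : l < N -> ~~ vert s l ->
  adj s (nd l (gen_at l).-1) (nd l (gen_at l)) /\
  adj s (nd l.+1 (gen_at l).-1) (nd l.+1 (gen_at l)).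
Proof.
move=> lN h; pose c := Ordinal lN.
have e : forall p, nd l p = (c, Ordinal (ltn_pmod p (isT : 0 < 4))).
  by move=> p; congr (_, _); apply/val_inj; rewrite /= modn_small.
have [g1 g2] : (gen_at l).-1 %% 4 = (gen_at l).-1 /\ gen_at l %% 4 = gen_at l.
  by have := gen_beta_lt c; rewrite gen_beta /=; lia.
split; apply/existsP; exists c; rewrite ?e /local_edge /= gen_beta sgn_beta -bitE -/(vert s c) h /=.
  by rewrite g1 g2 !eqxx !orbT.
by rewrite -!val_eqE /= g1 g2 !eqxx ?orbT.
Qed.

Lemma adj_elim s (R : node -> node -> Prop) : (forall x y, R x y -> R y x) ->
  (forall l p, l < N -> p < 4 ->
    (p != (gen_at l).-1) && (p != gen_at l) || vert s l -> R (nd l p) (nd l.+1 p)) ->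
  (forall l, l < N -> ~~ vert s l ->
    R (nd l (gen_at l).-1) (nd l (gen_at l)) /\
    R (nd l.+1 (gen_at l).-1) (nd l.+1 (gen_at l))) ->
  forall x y, adj s x y -> R x y.
Proof.
move=> Rs Rv Rh x y /existsP[c].
suff aux z t : local_edge s c z t -> R z t by case/orP=> /aux // /Rs.
case: z t => [l p] [l' p']; rewrite /local_edge /= gen_beta sgn_beta -bitE -/(vert s c).
case/or3P.
- case/and5P=> /eqP-> /eqP-> /eqP/val_inj-> h1 h2.
  have := Rv c p' (ltn_ord _) (ltn_ord _); rewrite h1 h2 => /(_ isT).
  by rewrite nd_ord nd_ordS.
- case/and4P=> v /eqP-> /eqP-> /eqP/val_inj->.
  have := Rv c p' (ltn_ord _) (ltn_ord _); rewrite v orbT => /(_ isT).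
  by rewrite nd_ord nd_ordS.
case/and4P=> v h /eqP e1 /eqP e2; have [] := Rh c (ltn_ord _) v.
rewrite -e1 -e2 !nd_ord !nd_ordS.
by case/orP: h => /andP[/eqP-> /eqP->].
Qed.

Definition core s : seq bool := mkseq (bit s) 12.

Lemma nth_core s l : l < 12 -> nth false (core s) l = bit s l.
Proof. exact: nth_mkseq. Qed.

(** A negative crossing is horizontal in its 0-resolution. This counts the horizontal smoothings of
    the tail below level [l], and so indexes the region of the tail at that level. *)
Definition zeros s l : nat := count (fun i => ~~ bit s i) (iota 12 (l - 12)).

Lemma zerosS s l : 12 <= l -> zeros s l.+1 = zeros s l + ~~ bit s l.
Proof.
by move=> l12; rewrite /zeros subSn // -[(l - 12).+1]addn1 iotaD count_cat /= addn0 subnKC.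
Qed.

Lemma zeros_le12 s l : l <= 12 -> zeros s l = 0.
Proof. by rewrite /zeros -subn_eq0 => /eqP->. Qed.

Lemma zeros_mono s : {homo zeros s : l l' / l <= l'}.
Proof.
move=> l l' ll'; rewrite /zeros -(subnKC (leq_sub2r 12 ll')) iotaD count_cat.
exact: leq_addr.
Qed.

Definition total_zeros s := zeros s N.

(** Below the first horizontal smoothing lies the circle of node 50, at level 12; above the last one
    lies that of node 2, at level 0. Small circle [t] receives [51 + t], beyond the 52 core
    numbers. *)
Definition tail_colour b m t : nat :=
  if t == 0 then rep b 50 else if t == m then rep b 2 else 51 + t.

Definition colour_at s l p : nat :=
  if l < 12 then rep (core s) (4 * l + p)
  else if p < 2 then rep (core s) p
  else tail_colour (core s) (total_zeros s) (zeros s l).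

Definition colour s (x : node) : nat := colour_at s x.1 x.2.

Lemma colour_nd s l p : 0 < total_zeros s -> l <= N -> p < 4 ->
  colour s (nd l p) = colour_at s l p.
Proof.
move=> m_gt0 lN p4; have e2 : ((nd l p).2 : nat) = p by exact: modn_small.
rewrite /colour e2; move: lN; rewrite leq_eqVlt => /predU1P[eN|lN]; last first.
  by have -> : ((nd l p).1 : nat) = l by exact: modn_small.
have -> : ((nd l p).1 : nat) = 0 by rewrite eN; exact: modnn.
have N12 : (l < 12) = false by rewrite eN size_beta; lia.
have -> : colour_at s 0 p = rep (core s) p by [].
rewrite /colour_at N12; case: ifP => // p2.
rewrite /tail_colour eN -/(total_zeros s) eqxx (gtn_eqF m_gt0).
(* At the top of the tail both right-hand positions have the colour of node 2; node 3 shares it by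
   the closure edge from 2 to 3. *)
have [_ _ _ h] := rep_closure (core s).
by case: p p4 p2 {e2} => [|[|[|[|p]]]].
Qed.

Lemma colour_at_core s l p : l <= 12 -> p < 4 -> colour_at s l p = rep (core s) (4 * l + p).
Proof.
rewrite leq_eqVlt /colour_at => /predU1P[->|->] // p4.
have [h1 h2 h3 _] := rep_closure (core s).
rewrite /tail_colour zeros_le12 //=.
by case: p p4 => [|[|[|[|p]]]].
Qed.

Lemma connect_colour_eq s (x y : node) : 0 < total_zeros s ->
  connect (adj s) x y -> colour s x = colour s y.
Proof.
move=> m_gt0; case/connectP=> p + ->.
suff h u v : adj s u v -> colour s u = colour s v.
  by elim: p x => //= z p IHp x /andP[/h-> /IHp].
have nlt l : l < 12 -> l.+1 <= N by rewrite size_beta; lia.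
elim/adj_elim => {u v} [//|l q lN q4|l lN].
  rewrite !colour_nd ?(ltnW lN) //; case: (ltnP l 12) => l12 h.
    rewrite !colour_at_core ?(ltnW l12) //.
    rewrite mulnS [4 + _]addnC.
    apply: (@rep_edge _ (4 * l + q, 4 * l + 4 + q)); apply/mem_core_edges; left.
    exists l, q; split=> //; move: h; rewrite /gen_at /vert l12 nth_core //= orbC.
    by case: (bit s l).
  have [f1 f2] : (l < 12) = false /\ (l.+1 < 12) = false by lia.
  move: h; rewrite /colour_at /gen_at /vert f1 f2 => h.
  case: ifP => // q2; rewrite zerosS //; suff -> : bit s l by rewrite addn0.
  by move: h; case: (bit s l) => //; rewrite orbF; lia.
move=> h; have g : gen_at l < 4 by have := gen_beta_lt (Ordinal lN); rewrite gen_beta => /andP[].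
rewrite !colour_nd ?(ltnW lN) //; try lia.
case: (ltnP l 12) => l12; last first.
  have [f1 f2] : (l < 12) = false /\ (l.+1 < 12) = false by lia.
  by rewrite /colour_at /gen_at f1 f2.
rewrite !colour_at_core ?(ltnW l12) //; try lia.
have {}h : nth false (core s) l by move: h; rewrite /vert nth_core // l12; case: (bit s l).
rewrite /gen_at l12 /= mulnS [4 + _]addnC; split.
  apply: (@rep_edge _ (4 * l + l %% 3, 4 * l + (l %% 3).+1)); apply/mem_core_edges; right; left.
  by exists l; split=> //; left.
apply: (@rep_edge _ (4 * l + 4 + l %% 3, 4 * l + 4 + (l %% 3).+1)); apply/mem_core_edges; right; left.
by exists l; split=> //; right.
Qed.

(** The crossing found is the first horizontal smoothing at or above level [l], the one that joins
    the two right-hand strands there. *)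
Lemma first_zero s l l' : 12 <= l <= l' -> zeros s l < zeros s l' ->
  exists2 c, l <= c < l' & zeros s c = zeros s l /\ ~~ bit s c.
Proof.
elim: l' => [|l' IHl] h z; first lia.
have [e|ne] := eqVneq l l'.+1; first by move: z; rewrite e ltnn.
have ll' : 12 <= l <= l' by lia.
have := zeros_mono s (proj2 (andP ll')); rewrite leq_eqVlt => /predU1P[e|lt].
  exists l'; [lia | split=> //]; move: z; rewrite zerosS; last lia.
  by rewrite e; case: (bit s l'); rewrite // addn0 ltnn.
by have [c hc h'] := IHl ll' lt; exists c => //; lia.
Qed.

Lemma last_zero s l l' : 12 <= l <= l' -> zeros s l < zeros s l' ->
  exists2 c, l <= c < l' & zeros s c.+1 = zeros s l' /\ ~~ bit s c.
Proof.
elim: l' => [|l' IHl] h z; first lia.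
have [e|ne] := eqVneq l l'.+1; first by move: z; rewrite e ltnn.
have ll' : 12 <= l <= l' by lia.
have [b|b] := boolP (bit s l'); last by exists l'; [lia | split].
have e : zeros s l'.+1 = zeros s l' by rewrite zerosS ?b ?addn0 //; lia.
rewrite e in z *; have [c hc h'] := IHl ll' z; exists c => //; lia.
Qed.

Lemma zeros_onto s l t : t <= zeros s l -> exists2 l', l' <= l & zeros s l' = t.
Proof.
elim: l => [|l IHl]; first by rewrite zeros_le12 // leqn0 => /eqP->; exists 0.
rewrite leq_eqVlt => /predU1P[->|]; first by exists l.+1.
case: (ltnP l 12) => l12; first by rewrite zeros_le12.
rewrite zerosS // => h; have /IHl[l' ? ?] : t <= zeros s l by move: h; case: (bit s l) => /=; lia.
by exists l' => //; lia.
Qed.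

Lemma gen_at_tail l : 12 <= l -> gen_at l = 3.
Proof. by move=> h; rewrite /gen_at ltnNge h. Qed.

Lemma vert_tail s l : 12 <= l -> vert s l = bit s l.
Proof. by move=> h; rewrite /vert ltnNge h; case: (bit s l). Qed.

(** The first two positions never meet a tail crossing. The other two run straight as long as no
    horizontal smoothing intervenes, which is what equal counts express. *)
Lemma connect_straight s l l' p : 12 <= l <= l' -> l' <= N -> p < 4 ->
  (p < 2) || (zeros s l == zeros s l') -> connect (adj s) (nd l p) (nd l' p).
Proof.
elim: l' => [|l' IHl] h lN p4 z; first lia.
have [->|ne] := eqVneq l l'.+1; first exact: connect0.
have l12 : 12 <= l' by lia.
have z1 := @zeros_mono s l l'; have z2 := zerosS s l12.
apply: (connect_trans (y := nd l' p)); first by apply: IHl => //; lia.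
apply: connect1; apply: adj_vert => //.
rewrite gen_at_tail // vert_tail //.
by case: (bit s l') z2 => /=; lia.
Qed.

Lemma connect_cap s l : 0 < total_zeros s -> 12 <= l <= N ->
  connect (adj s) (nd l 2) (nd l 3).
Proof.
move=> m_gt0 l12; have sym := @connect_adj_sym 4 _ s.
(* If the count has reached its total, the last horizontal smoothing below [l] joins the strands;
   otherwise the first one above does. *)
have := zeros_mono s (proj2 (andP l12)); rewrite leq_eqVlt => /predU1P[e|lt].
  have [||c hc [h b]] := @last_zero s 12 l; first lia.
    by rewrite e zeros_le12.
  have [||_ h'] := @adj_horiz s c; [lia | by rewrite vert_tail //; lia |].
  rewrite gen_at_tail in h'; last lia.
  apply: (connect_trans (y := nd c.+1 2)).
    by rewrite sym; apply: connect_straight; rewrite ?h ?eqxx //; lia.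
  apply: (connect_trans (connect1 h')).
  by apply: connect_straight; rewrite ?h ?eqxx //; lia.
have [c hc [h b]] := first_zero l12 lt.
have [||h' _] := @adj_horiz s c; [lia | by rewrite vert_tail //; lia |].
rewrite gen_at_tail in h'; last lia.
apply: (connect_trans (y := nd c 2)).
  by apply: connect_straight; rewrite ?h ?eqxx //; lia.
apply: (connect_trans (connect1 h')); rewrite sym.
by apply: connect_straight; rewrite ?h ?eqxx //; lia.
Qed.

Lemma connect_tail s l l' p p' : 0 < total_zeros s -> 12 <= l <= N -> 12 <= l' <= N ->
  2 <= p < 4 -> 2 <= p' < 4 -> zeros s l = zeros s l' ->
  connect (adj s) (nd l p) (nd l' p').
Proof.
move=> m_gt0 hl hl' hp hp' z; have sym := @connect_adj_sym 4 _ s.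
have cap q i : 12 <= i <= N -> 2 <= q < 4 -> connect (adj s) (nd i q) (nd i 2).
  move=> hi hq; have [->|->] : q = 2 \/ q = 3 by lia.
    exact: connect0.
  by rewrite sym connect_cap.
apply: (connect_trans (cap _ _ hl hp)); rewrite sym.
apply: (connect_trans (cap _ _ hl' hp')).
case: (leqP l l') => ll'; [rewrite sym|]; apply: connect_straight; rewrite ?z ?eqxx ?orbT //; lia.
Qed.

Definition core_node i : node := nd (i %/ 4) (i %% 4).

Lemma core_nodeE l p : p < 4 -> core_node (4 * l + p) = nd l p.
Proof.
move=> p4; rewrite /core_node mulnC modnMDl modn_small //.
by rewrite divnMDl // divn_small // addn0.
Qed.

(** The closure edges are realised in the tail: two straight strands, and the joins of the
    right-hand strands at levels 12 and [N]. *)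
Lemma core_node_rep s i : 0 < total_zeros s -> i < 52 ->
  connect (adj s) (core_node i) (core_node (rep (core s) i)).
Proof.
move=> m_gt0; have sym := @connect_adj_sym 4 _ s.
move=> i52; apply: (proj1 (@rep_class (fun i j => connect (adj s) (core_node i) (core_node j)) (core s) _ _ _ _ i i52)).
- by move=> j; apply: connect0.
- by move=> j h; rewrite sym.
- by move=> j h l; apply: connect_trans.
have nN l : l < 12 -> l < N by rewrite size_beta; lia.
have N12 : 12 <= N by rewrite size_beta.
have e4 l q : 4 * l + 4 + q = 4 * l.+1 + q by rewrite mulnS; lia.
move=> e /mem_core_edges[[l [p [l12 p4 h ->]]]|[[l [l12 b h]]|]] /=.
- rewrite e4 !core_nodeE //; apply: connect1.
  apply: adj_vert; rewrite ?nN // /gen_at /vert l12.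
  by move: h; rewrite nth_core // orbC; case: (bit s l).
- rewrite nth_core // in b.
  have [||h1 h2] := @adj_horiz s l; rewrite ?nN // /vert ?l12 ?b //.
  rewrite /gen_at l12 /= in h1 h2.
  case: h => -> /=.
    by rewrite !core_nodeE ?connect1 //; lia.
  by rewrite !e4 !core_nodeE ?connect1 //; lia.
have ndN q : nd N q = nd 0 q by congr (_, _); apply/val_inj; rewrite /= modnn.
have [e0 e1 e2 e3] : [/\ core_node 0 = nd N 0, core_node 1 = nd N 1, core_node 2 = nd N 2 & core_node 3 = nd N 3].
  by rewrite !ndN.
rewrite !inE => /or4P[] /eqP-> /=; rewrite ?e0 ?e1 ?e2 ?e3.
- by rewrite -[core_node 48]/(nd 12 0) connect_straight // N12.
- by rewrite -[core_node 49]/(nd 12 1) connect_straight // N12.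
- by apply: connect_cap; rewrite ?N12.
- by apply: connect_cap; rewrite ?leqnn ?N12.
Qed.

Lemma colour_cases s (x : node) : 0 < total_zeros s ->
  (exists i, [/\ i < 52, colour s x = rep (core s) i & connect (adj s) x (core_node i)]) \/
  (exists l, [/\ 12 <= l < N, 0 < zeros s l < total_zeros s, colour s x = 51 + zeros s l &
     connect (adj s) x (nd l 2)]).
Proof.
move=> m_gt0; case: x => c p; rewrite -(nd_ord c p).
have cN := ltn_ord c; have p4 := ltn_ord p; have sym := @connect_adj_sym 4 _ s.
rewrite colour_nd ?(ltnW cN) //; case: (ltnP c 12) => c12.
  left; exists (4 * c + p); rewrite core_nodeE // colour_at_core ?(ltnW c12) //; split=> //; lia.
have N12 : 12 <= N by rewrite size_beta.
have ndN q : nd N q = nd 0 q by congr (_, _); apply/val_inj; rewrite /= modnn.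
have c12' : (c < 12) = false by lia.
rewrite /colour_at c12'; case: ifP => p2.
  left; exists p; split=> //; first lia.
  rewrite (_ : core_node p = nd N p) ?connect_straight ?c12 ?p2 ?(ltnW cN) //.
  by rewrite ndN -[X in core_node X]add0n -[0]/(4 * 0) core_nodeE.
rewrite /tail_colour; case: eqP => z0.
  left; exists 50; split=> //; rewrite -[core_node 50]/(nd 12 2).
  by apply: connect_tail; rewrite ?z0 ?zeros_le12 //; lia.
case: eqP => zm; last first.
  right; exists c; split=> //; first by rewrite c12.
    by have := zeros_mono s (ltnW cN); rewrite -/(total_zeros s); lia.
  by apply: connect_tail; rewrite //; lia.
left; exists 2; split=> //; rewrite -[core_node 2]/(nd 0 2) -ndN.
by apply: connect_tail; rewrite //; lia.
Qed.

(** Core colours are below 52 and those of small circles at least 52, so the two kinds never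
    collide. Within each kind [core_node_rep] or [connect_tail] supplies the path. *)
Lemma connect_colour s (x y : node) : 0 < total_zeros s ->
  connect (adj s) x y = (colour s x == colour s y).
Proof.
move=> m_gt0; apply/idP/eqP => [|e]; first exact: connect_colour_eq.
have sym := @connect_adj_sym 4 _ s; move: e.
have [[i [i52 -> xi]]|[l [hl zl -> xl]]] := colour_cases x m_gt0;
have [[j [j52 -> yj]]|[l' [hl' zl' -> yl]]] := colour_cases y m_gt0 => e.
- apply: connect_trans xi _; rewrite sym; apply: connect_trans yj _.
  apply: connect_trans (core_node_rep m_gt0 j52) _; rewrite -e sym.
  exact: core_node_rep.
- by have := rep_lt (core s) i52; lia.
- by have := rep_lt (core s) j52; lia.
- apply: connect_trans xl _; rewrite sym; apply: connect_trans yl _.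
  by apply: connect_tail; lia.
Qed.

End Circles.

(** * A cocycle that is nonzero on psi *)

Definition even_at l := if odd (gen_at l) then (gen_at l).-1 else gen_at l.
Definition odd_at l := if odd (gen_at l) then gen_at l else (gen_at l).-1.

Definition entry : Type := (seq bool * seq nat)%type.

(** The bound forces the label [v_-] on all small circles. *)
Definition label (e : entry) (a : nat) : bool := (a < 52) && (a \in e.2).

Definition pattern (T : seq nat) : seq bool := [seq l \in T | l <- iota 0 12].

(* An entry lists the positive crossings in the 1-resolution and the
   representatives of the circles labelled v_+.  Except for the first, which is
   the value on psi, the entries were found by solving the linear system over
   Z/2 that expresses closedness. *)
Definition cert : seq entry :=
  [seq (pattern e.1, e.2) | e <- [::
    ([::], [::]);
    ([:: 2], [::]);
    ([:: 1; 2], [::]);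
    ([:: 1; 10], [::]);
    ([:: 2; 10], [::]);
    ([:: 1; 2; 10], [::]);
    ([:: 1; 7; 10], [:: 42]);
    ([:: 1; 7; 10], [:: 51]);
    ([:: 5; 7; 10], [:: 42]);
    ([:: 5; 7; 10], [:: 51]);
    ([:: 2; 5; 7; 10], [:: 23; 42]);
    ([:: 2; 5; 7; 10], [:: 42; 51]);
    ([:: 2; 5; 7; 10], [:: 23; 51]);
    ([:: 1; 2; 5; 7; 10], [:: 42; 51]);
    ([:: 1; 2; 5; 7; 10], [:: 23; 51]);
    ([:: 1; 2; 5; 7; 10], [:: 23; 42])]].

(* [r] and [r'] list the representatives of the core nodes before and after a
   surgery, and [fl] the labels of the core nodes before it; the circles
   represented by [a] and [a'] are ignored (52 represents no circle). *)
Definition core_agree (r r' : seq nat) (fl : seq bool) (e : entry) (a a' : nat) : bool :=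
  all (fun i => [|| nth 0 r i == a, nth 0 r i == a' |
                    label e (nth 0 r' i) == nth false fl i]) (iota 0 52).

Definition core_rule (r r' : seq nat) (l : nat) (fl : seq bool) (e : entry) : bool :=
  let u := 4 * l + even_at l in let d := 4 * l.+1 + odd_at l in
  core_agree r r' fl e (nth 0 r u) (nth 0 r d) &&
  surgery_rule (nth 0 r u != nth 0 r d) (nth false fl u) (nth false fl d)
    (label e (nth 0 r' u)) (label e (nth 0 r' d)).

(* The circle of node [q] drops from v_+ to v_-: the effect of merging it with
   a small circle labelled v_-. *)
Definition lowered_at (r : seq nat) (q : nat) (fl : seq bool) (e : entry) : bool :=
  [&& nth false fl q, ~~ label e (nth 0 r q) & core_agree r r fl e (nth 0 r q) 52].

Definition xor_sum (T : Type) (f : T -> bool) (s : seq T) : bool :=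
  foldr (fun i a => f i (+) a) false s.

(** The coboundary of the cochain given by [cert], at core resolution [b] and labels [fl], with all
    small circles [v_-]. The first sum is over positive crossings. In the second, [m] is
    [count id b + 1]: for [m = 1] the only horizontal smoothing is split open, otherwise the two
    ends of the tail, at nodes 50 and 2, contribute. *)
Definition cocycle_defect (b : seq bool) (r : seq nat) (rs : seq (seq nat)) (fl : seq bool) : bool :=
  xor_sum (fun l => if nth false b l then false else
     xor_sum (fun e => if e.1 == set_nth false b l true
                       then core_rule r (nth [::] rs l) l fl e else false) cert)
    (iota 0 12) (+)
  xor_sum (fun e => if e.1 == b then
      if count id b == 0 then all negb fl
      else lowered_at r 50 fl e (+) lowered_at r 2 fl e else false) cert.

Definition subseqs (T : Type) (s : seq T) : seq (seq T) :=
  foldr (fun a ss => ss ++ [seq a :: t | t <- ss]) [:: [::]] s.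

Lemma filter_subseqs (T : eqType) (a : pred T) (s : seq T) : filter a s \in subseqs s.
Proof.
elim: s => //= x s IHs; rewrite mem_cat; case: (a x); last by rewrite IHs.
by rewrite orbC (mem_map (f := cons x)) ?IHs // => t t' [].
Qed.

Definition patterns : seq (seq bool) := [seq pattern T | T <- subseqs [:: 1; 2; 5; 7; 10]].

(** The lists are shared by all labellings of a resolution. A resolution outside [patterns] carries
    no entry of [cert]. *)
Definition flipped_reps (b : seq bool) : seq (seq nat) :=
  [seq (let b' := set_nth false b l true in if b' \in patterns then reps b' else [::])
  | l <- iota 0 12].

(** The finite computation: 32 core resolutions, each with every choice of the set of circles
    labelled [v_+]. *)
Lemma cocycle_check : all (fun b => let r := reps b in let rs := flipped_reps b in
    all (fun pl => ~~ cocycle_defect b r rs [seq a \in pl | a <- r]) (subseqs (undup r)))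
  patterns.
Proof. by vm_compute. Qed.

(** The second clause concerns [m = 0], where colours do not describe the circles and only the
    constant label [v_-] is safe. The third lets a pattern be traced back through a flip. *)
Lemma cert_check : all (fun e => [&& e.1 \in patterns, (count id e.1 == 0) ==> (e.2 == [::]) &
    all (fun l => set_nth false e.1 l false \in patterns) (iota 0 12)]) cert.
Proof. by vm_compute. Qed.

Lemma xor_sumE (T : Type) (f : T -> bool) s : xor_sum f s = \big[addb/false]_(i <- s) f i.
Proof. by elim: s => [|x s IHs]; rewrite ?big_nil ?big_cons //= IHs. Qed.

(** * The total contribution of the tail crossings *)

Section Tail.
Variables (b : seq bool) (fl : seq bool) (F : nat -> bool) (e : entry).
Hypothesis flE : forall i, i < 52 -> nth false fl i = F (rep b i).
Notation r := (reps b).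

Lemma core_agreeC r' a a' : core_agree r r' fl e a a' = core_agree r r' fl e a' a.
Proof. by apply: eq_all => i; rewrite orbCA. Qed.

Lemma core_agree_big r' a a' : 52 <= a' -> core_agree r r' fl e a a' = core_agree r r' fl e a 52.
Proof.
move=> ha; apply: eq_in_all => i; rewrite mem_iota => /andP[_ i52].
by have lt := rep_lt b i52; congr (_ || (_ || _)); lia.
Qed.

(** Trades the exemption of the circle of [q] for a condition on its label; 52 exempts nothing,
    being above every core representative. *)
Lemma core_agree_at q : q < 52 ->
  core_agree r r fl e (rep b q) 52 && (label e (rep b q) == F (rep b q)) = core_agree r r fl e 52 52.
Proof.
move=> q52; apply/andP/allP => [[/allP h /eqP eq_q] i i52|h].
  have i52' : i < 52 by rewrite mem_iota in i52.
  have := h i i52; rewrite flE //; case: eqP => [-> _|_ /=]; last by move=> ->; rewrite orbT.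
  by rewrite eq_q eqxx !orbT.
have no i : i \in iota 0 52 -> label e (rep b i) == F (rep b i).
  move=> i52; have i52' : i < 52 by rewrite mem_iota in i52.
  have := h i i52; rewrite flE // orbA => /orP[|//].
  by have := rep_lt b i52'; lia.
split; last by apply: no; rewrite mem_iota.
by apply/allP=> i i52; rewrite flE ?no ?orbT //; rewrite mem_iota in i52.
Qed.

Variable m : nat.
Notation T := (tail_colour b m).

(** Targets label their small circles [v_-], so the small circles away from smoothing [j], among the
    numbers 1 to [m - 1], must be [v_-] already. *)
Definition tail_agree j : bool :=
  all (fun t => [|| t == j, t == j.+1 | ~~ F (51 + t)]) (iota 1 m.-1).

Definition no_small_plus : bool := all (fun t => ~~ F (51 + t)) (iota 1 m.-1).

(** Straightening smoothing [j] fuses the regions [j] and [j.+1] into region [j] of a tail with one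
    horizontal smoothing fewer, hence [m.-1] and the single new label [v]. *)
Definition tail_rule j : bool :=
  let v := label e (tail_colour b m.-1 j) in
  [&& core_agree r r fl e (T j) (T j.+1), tail_agree j &
      surgery_rule (T j != T j.+1) (F (T j)) (F (T j.+1)) v v].

Lemma tail_colour0 n : tail_colour b n 0 = rep b 50.
Proof. by []. Qed.

Lemma tail_colour_max n : 0 < n -> tail_colour b n n = rep b 2.
Proof. by rewrite /tail_colour eqxx; case: n. Qed.

Lemma tail_colour_small n t : 0 < t < n -> tail_colour b n t = 51 + t.
Proof. by rewrite /tail_colour; case: eqP => [->|_] //; case: eqP => [->|] //; rewrite ltnn andbF. Qed.

Lemma label_small t : 0 < t -> label e (51 + t) = false.
Proof. by move=> t0; rewrite /label; case: ltnP => //; lia. Qed.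

(** Merging with [v_+] returns the other label. Absorption into either neighbour therefore requires
    the same condition [Q]: the core labels persist and no other small circle is [v_+]. *)
Lemma tail_rule_plus t0 : 1 < m -> 0 < t0 < m -> F (51 + t0) ->
  let Q := core_agree r r fl e 52 52 && all (fun t => (t == t0) || ~~ F (51 + t)) (iota 1 m.-1) in
  tail_rule t0 = Q /\ tail_rule t0.-1 = Q.
Proof.
move=> m1 t0m Ft0 Q.
have lt50 := rep_lt b (isT : 50 < 52); have lt2 := rep_lt b (isT : 2 < 52).
split; rewrite /tail_rule.
  rewrite (tail_colour_small t0m); have [e'|ne] := eqVneq t0.+1 m.
    have t0E : t0 = m.-1 by lia.
    rewrite e' (tail_colour_max (ltnW m1)) core_agreeC (@core_agree_big _ _ (51 + t0)); last lia.
    rewrite (_ : tail_colour b m.-1 t0 = rep b 2); last by rewrite t0E tail_colour_max //; lia.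
    rewrite (_ : (51 + t0 != rep b 2) = true); last lia.
    rewrite Ft0 /surgery_rule orTb !andTb andbb /tail_agree.
    rewrite /Q -(core_agree_at (isT : 2 < 52)) -andbA.
    case: (core_agree _ _ _ _ _ _) => //; rewrite !andTb andbC; case: (_ == _) => //; rewrite !andTb.
    apply: eq_in_all => t; rewrite mem_iota => ht; congr (_ || _).
    by case: eqP => // h; lia.
  rewrite tail_colour_small; last lia.
  rewrite (@core_agree_big _ _ (51 + t0.+1)); last lia.
  rewrite core_agreeC (@core_agree_big _ _ (51 + t0)); last lia.
  rewrite tail_colour_small; last lia.
  rewrite label_small; last lia.
  rewrite /Q; case: (core_agree _ _ _ _ _ _) => //; rewrite !andTb (_ : (_ != _) = true); last by lia.
  rewrite /surgery_rule Ft0 orTb !andTb.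
  apply/andP/allP => [[/allP h1 h2] t ht|h].
    by have := h1 t ht; case: (t == t0) => //=; case: eqP => [->|].
  split; last by have := h t0.+1; rewrite mem_iota; case: (F _) => //=; lia.
  by apply/allP=> t /h; case: (t == t0) => //= ->; rewrite orbT.
have St : t0.-1.+1 = t0 by lia.
rewrite /tail_agree St (tail_colour_small t0m).
rewrite (@core_agree_big _ _ (51 + t0)); last lia.
(* The lower neighbour is the circle of node 50 when [t0 = 1], and another small circle
   otherwise. *)
have [e'|ne] := eqVneq t0 1.
  have -> : t0.-1 = 0 by rewrite e'.
  rewrite !tail_colour0.
  rewrite (_ : (rep b 50 != 51 + t0) = true); last lia.
  rewrite Ft0 /surgery_rule orbT andbb andbT andTb.
  rewrite /Q -(core_agree_at (isT : 50 < 52)) -andbA.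
  case: (core_agree _ _ _ _ _ _) => //; rewrite !andTb andbC; case: (_ == _) => //; rewrite !andTb.
  apply: eq_in_all => t; rewrite mem_iota => ht.
  by rewrite (_ : (t == 0) = false) //; lia.
rewrite tail_colour_small; last lia.
rewrite core_agreeC (@core_agree_big _ _ (51 + t0.-1)); last lia.
rewrite tail_colour_small; last lia.
rewrite label_small; last lia.
rewrite /Q; case: (core_agree _ _ _ _ _ _) => //; rewrite !andTb (_ : (_ != _) = true); last by lia.
rewrite /surgery_rule Ft0 orbT andbT andTb.
apply/andP/allP => [[/allP h1 h2] t ht|h].
  have := h1 t ht; case: (t == t0); rewrite ?orbT //=; case: eqP => [->|] //.
split; last by have := h t0.-1; rewrite mem_iota; case: (F _) => //=; lia.
by apply/allP=> t /h; case: (t == t0) => [_|/= ->]; rewrite !orbT.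
Qed.

(* A small circle labelled v_+ can be absorbed from either side, and the two
   contributions cancel. *)
Lemma tail_sum : 1 < m ->
  \big[addb/false]_(0 <= j < m) tail_rule j =
  no_small_plus && (lowered_at r 50 fl e (+) lowered_at r 2 fl e).
Proof.
move=> m1; case: (boolP no_small_plus) => [np|]; last first.
  rewrite -has_predC => /hasP[t0]; rewrite mem_iota /= negbK => ht Ft0.
  have [|h1 h2] := tail_rule_plus m1 _ Ft0; first lia.
  rewrite (bigD1_seq t0) ?mem_index_iota ?iota_uniq //=; last lia.
  rewrite -big_filter (bigD1_seq t0.-1) ?filter_uniq ?iota_uniq //=; last first.
    by rewrite mem_filter mem_index_iota; apply/andP; split; [apply/eqP|]; lia.
  (* The terms [t0] and [t0.-1] cancel. Any other smoothing leaves circle [t0] with its label [v_+],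
     which no target has. *)
  rewrite h1 h2 big1_seq ?addbF ?addbb // => j; rewrite mem_filter => /andP[j1 /andP[j0 _]].
  apply/negbTE; rewrite /tail_rule !negb_and; apply/orP; right; apply/orP; left.
  apply/allPn; exists t0; rewrite ?mem_iota //.
  by rewrite !negb_or negbK Ft0 andbT; apply/andP; split; apply/eqP; move/eqP: j1; move/eqP: j0; lia.
have Fs t : 0 < t < m -> F (51 + t) = false.
  by move=> ht; apply/negbTE; have /allP := np; apply; rewrite mem_iota; lia.
have ta j : tail_agree j.
  by apply/allP=> t; have /allP h := np; move/h ->; rewrite !orbT.
have lt50 := rep_lt b (isT : 50 < 52); have lt2 := rep_lt b (isT : 2 < 52).
have last_term (f : nat -> bool) : \big[addb/false]_(m.-1 <= j < m) f j = f m.-1.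
  by rewrite -{2}(prednK (ltnW m1)) big_nat1.
rewrite (big_ltn (ltnW m1)) (big_cat_nat (n := m.-1)) ?last_term; try lia.
(* The smoothings strictly between the first and the last merge two small circles labelled [v_-],
   which gives zero. *)
rewrite big1_seq ?addFb => [|j]; last first.
  rewrite mem_index_iota => hj; rewrite /tail_rule !tail_colour_small ?Fs; try lia.
  by rewrite (_ : (51 + j != 51 + j.+1) = true) ?andbF //; lia.
rewrite [LHS]/=; congr (_ (+) _); rewrite /tail_rule /lowered_at.
  rewrite !tail_colour0 ta tail_colour_small ?Fs; try lia.
  rewrite (@core_agree_big _ _ (51 + 1)); last lia.
  rewrite (_ : (rep b 50 != 51 + 1) = true); last lia.
  rewrite flE // /surgery_rule.
  by case: (core_agree _ _ _ _ _ _); case: (F _); case: (label _ _).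
rewrite prednK ?(ltnW m1) // ta (tail_colour_max (ltnW m1)) (@tail_colour_small m) ?Fs; try lia.
rewrite core_agreeC (@core_agree_big _ _ (51 + m.-1)); last lia.
rewrite (_ : (51 + m.-1 != rep b 2) = true); last lia.
rewrite flE // /surgery_rule tail_colour_max; last lia.
by case: (core_agree _ _ _ _ _ _); case: (F _); case: (label _ _).
Qed.

End Tail.

(** * Surgeries on [beta k] in terms of colours *)

Section Cocycle.
Variable k : nat.
Notation N := (size (beta k)).
Notation node := ('I_N * 'I_4)%type.
Notation resolution := {ffun 'I_N -> bool}.
Notation gen_ok := (@gen_beta_lt k).
Notation nd := (nd k).
Notation core_node := (core_node k).
Implicit Types (s : resolution) (c : 'I_N) (l p : nat) (X : node -> bool).

Lemma even_at_lt l : even_at l < 4 /\ odd_at l < 4.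
Proof. by rewrite /even_at /odd_at /gen_at; case: (l < 12); case: (odd _); lia. Qed.

Lemma in_up_nd c : in_up gen_ok c = nd c (even_at c).
Proof.
rewrite /in_up -nd_ord; congr (nd _ _).
by rewrite /even_pos /even_at gen_beta; case: ifP => _; rewrite -?gen_beta //; apply: val_lower_pos.
Qed.

Lemma in_down_nd c : in_down gen_ok c = nd c.+1 (odd_at c).
Proof.
rewrite /in_down -nd_ordS; congr (nd _ _).
by rewrite /odd_pos /odd_at gen_beta; case: ifP => _; rewrite -?gen_beta //; apply: val_lower_pos.
Qed.

(** Transfers a labelling from nodes to numbers; a number that is no colour counts as [v_-]. *)
Definition label_of s X (a : nat) : bool := [exists x, (colour s x == a) && X x].

Lemma label_ofE s X x : 0 < total_zeros s -> circle_constant s X ->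
  X x = label_of s X (colour s x).
Proof.
move=> m_gt0 cX; apply/idP/existsP => [Xx|[y /andP[]]]; first by exists x; rewrite eqxx.
by rewrite -connect_colour // => /cX ->.
Qed.

Lemma surgery_colour s c X Y : 0 < total_zeros s -> circle_constant s X ->
  surgery gen_ok s c X Y =
  let u := colour_at s c (even_at c) in let d := colour_at s c.+1 (odd_at c) in
  [forall x, [|| colour s x == u, colour s x == d | Y x == X x]] &&
  surgery_rule (u != d) (label_of s X u) (label_of s X d)
    (Y (nd c (even_at c))) (Y (nd c.+1 (odd_at c))).
Proof.
move=> m_gt0 cX; rewrite /surgery in_up_nd in_down_nd connect_colour // !(label_ofE _ m_gt0 cX).
have [h1 h2] := even_at_lt c; have cN := ltn_ord c.
rewrite !colour_nd ?(ltnW cN) //; congr (_ && _); apply: eq_forallb => x.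
rewrite (touchesE gen_ok) in_up_nd in_down_nd !connect_colour // !colour_nd ?(ltnW cN) //.
by rewrite implybE negbK orbA (label_ofE x m_gt0 cX).
Qed.

Lemma bit_flip s c l : bit (flip s c) l = if l == c then ~~ bit s c else bit s l.
Proof.
rewrite bitE /bit; case: insubP => [c' _ <-|h]; first by rewrite flipE val_eqE.
by case: eqP => // e; rewrite e ltn_ord in h.
Qed.

Lemma core_flip s c : c < 12 -> ~~ s c -> core (flip s c) = set_nth false (core s) c true.
Proof.
move=> c12 s_c; apply: (@eq_from_nth _ false).
  by rewrite size_set_nth !size_mkseq; apply/esym/maxn_idPr.
move=> i; rewrite size_mkseq => i12; rewrite nth_set_nth /= !nth_core // bit_flip bitE s_c.
by case: eqP.
Qed.

Lemma core_flip_tail s c : 12 <= c -> core (flip s c) = core s.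
Proof.
move=> c12; apply: (@eq_from_nth _ false); rewrite !size_mkseq // => i i12.
by rewrite !nth_core // bit_flip; case: eqP => // e; lia.
Qed.

Lemma zeros_flip s c l : c < 12 -> zeros (flip s c) l = zeros s l.
Proof.
move=> c12; apply: eq_in_count => i; rewrite mem_iota => hi.
by rewrite bit_flip; case: eqP => // e; lia.
Qed.

Lemma zeros_flip_tail s c l : 12 <= c -> ~~ s c -> zeros s l = zeros (flip s c) l + (c < l).
Proof.
move=> c12 s_c; elim: l => [|l IHl]; first by rewrite !zeros_le12.
case: (ltnP l 12) => l12; first by rewrite !zeros_le12 //; lia.
rewrite !zerosS // IHl bit_flip bitE s_c.
by case: eqVneq => [->|ne]; rewrite ?bitE ?(negbTE s_c); lia.
Qed.

Lemma total_zeros_flip s c : c < 12 -> total_zeros (flip s c) = total_zeros s.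
Proof. exact: zeros_flip. Qed.

Lemma total_zeros_flip_tail s c : 12 <= c -> ~~ s c ->
  total_zeros s = (total_zeros (flip s c)).+1.
Proof. by move=> c12 s_c; rewrite /total_zeros (zeros_flip_tail _ c12 s_c) ltn_ord addn1. Qed.

Lemma colour_core_node s i : 0 < total_zeros s -> i < 52 ->
  colour s (core_node i) = rep (core s) i.
Proof.
move=> m_gt0 i52; rewrite colour_nd //; try by rewrite ?size_beta; lia.
rewrite colour_at_core; try lia.
by congr nth; rewrite mulnC -divn_eq.
Qed.

Lemma small_node s t : 0 < t < total_zeros s -> exists l,
  [/\ 12 <= l < N, zeros s l = t & colour s (nd l 2) = 51 + t].
Proof.
move=> ht; have [|l lN zl] := @zeros_onto k s N t; first by rewrite -/(total_zeros s); lia.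
have l12 : 12 <= l by case: (leqP 12 l) => // h; move: zl; rewrite zeros_le12; lia.
have lN' : l < N.
  by rewrite ltn_neqAle lN andbT; apply/eqP => e; move: zl; rewrite e -/(total_zeros s); lia.
exists l; split; rewrite ?l12 // colour_nd //; try lia.
by rewrite /colour_at ltnNge l12 zl tail_colour_small.
Qed.

Definition mk_state s (e : entry) : state 4 (beta k) :=
  (s, [ffun x => label e (colour s x)]).

Definition core_labels X : seq bool := [seq X (core_node i) | i <- iota 0 52].

Lemma nth_core_labels s X i : 0 < total_zeros s -> circle_constant s X -> i < 52 ->
  nth false (core_labels X) i = label_of s X (rep (core s) i).
Proof.
move=> m_gt0 cX i52; rewrite (nth_map 0) ?size_iota // nth_iota //.
by rewrite (label_ofE _ m_gt0 cX) colour_core_node.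
Qed.

Lemma node_cases (x : node) :
  (exists2 i, i < 52 & x = core_node i) \/
  (exists2 l, 12 <= l < N & exists2 p, p < 4 & x = nd l p).
Proof.
case: x => c p; rewrite -nd_ord; have [cN p4] := (ltn_ord c, ltn_ord p).
case: (ltnP c 12) => c12.
  by left; exists (4 * c + p); [lia | rewrite core_nodeE].
by right; exists c; [rewrite c12 | exists p].
Qed.

(** A surgery at a positive crossing leaves the small circles in place, and its target labels them
    [v_-]: this is the factor [no_small_plus]. *)
Lemma surgery_core s c X e : 0 < total_zeros s -> circle_constant s X -> c < 12 -> ~~ s c ->
  surgery gen_ok s c X (mk_state (flip s c) e).2 =
  no_small_plus (label_of s X) (total_zeros s) &&
  core_rule (reps (core s)) (reps (set_nth false (core s) c true)) c (core_labels X) e.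
Proof.
move=> m_gt0 cX c12 s_c; have m_gt0' : 0 < total_zeros (flip s c) by rewrite total_zeros_flip.
rewrite surgery_colour //; have [h1 h2] := even_at_lt c; have cN := ltn_ord c.
rewrite !ffunE !colour_nd ?(ltnW cN) // !colour_at_core ?(ltnW c12) //.
rewrite /core_rule -core_flip //.
rewrite -!(nth_core_labels m_gt0 cX); try lia.
set u := 4 * c + _; set d := 4 * c.+1 + _.
rewrite andbA; congr (_ && _).
have [lu ld] : u < 52 /\ d < 52 by rewrite /u /d; lia.
apply/forallP/andP => [h|[/allP h1' /allP h2'] x].
  split.
    apply/allP=> t; rewrite mem_iota => ht; have [|l [hl zl cl]] := @small_node s t; first lia.
    have := h (nd l 2); rewrite cl ffunE (label_ofE _ m_gt0 cX) cl.
    have lu' := rep_lt (core s) lu; have ld' := rep_lt (core s) ld.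
    have n1 : (51 + t == rep (core s) u) = false by lia.
    have n2 : (51 + t == rep (core s) d) = false by lia.
    have l12 : (l < 12) = false by lia.
    rewrite colour_nd //; try lia.
    rewrite /colour_at l12 total_zeros_flip // zeros_flip // zl tail_colour_small; last lia.
    rewrite label_small; last lia.
    by rewrite n1 n2; case: (label_of _ _ _).
  apply/allP=> i; rewrite mem_iota => i52; have := h (core_node i).
  by rewrite ffunE !colour_core_node // (label_ofE _ m_gt0 cX) colour_core_node // (nth_core_labels m_gt0 cX).
have hi i : i < 52 -> colour s x = rep (core s) i -> colour (flip s c) x = rep (core (flip s c)) i ->
    [|| colour s x == rep (core s) u, colour s x == rep (core s) d | (mk_state (flip s c) e).2 x == X x].
  move=> i52 e1 e2; rewrite ffunE (label_ofE _ m_gt0 cX) e1 e2.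
  by have := h2' i; rewrite mem_iota i52 (nth_core_labels m_gt0 cX) // => /(_ isT).
have [[i i52 ex]|[l hl [p p4 ex]]] := node_cases x.
  by apply: (hi i) => //; rewrite ex colour_core_node.
have l12 : (l < 12) = false by lia.
have lN : l <= N by lia.
have E t : 0 < total_zeros t -> colour t x = colour_at t l p by move=> ?; rewrite ex colour_nd.
rewrite /colour_at l12 in E.
case: (ltnP p 2) E => p2 E; first by apply: (hi p); rewrite ?E ?p2 //; lia.
have E1 := E _ m_gt0; have E2 := E _ m_gt0'.
rewrite total_zeros_flip // zeros_flip // in E2.
(* The two end regions of the tail lie on the circles of nodes 50 and 2, so only genuinely small
   circles remain after these cases. *)
have [z0|z0] := eqVneq (zeros s l) 0.
  by apply: (hi 50); rewrite ?E1 ?E2 ?z0.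
have [zm|zm] := eqVneq (zeros s l) (total_zeros s).
  by apply: (hi 2); rewrite ?E1 ?E2 ?zm ?tail_colour_max.
have zlt : 0 < zeros s l < total_zeros s.
  by have := zeros_mono s lN; rewrite -/(total_zeros s); lia.
rewrite !(tail_colour_small _ zlt) in E1 E2.
have := h1' (zeros s l); rewrite mem_iota ffunE (label_ofE _ m_gt0 cX) E1 E2.
rewrite label_small; last lia.
by case: (label_of _ _ _) => [h|_]; rewrite ?orbT //; have := h _; lia.
Qed.

Lemma even_at_tail l : 12 <= l -> even_at l = 2 /\ odd_at l = 3.
Proof. by move=> l12; rewrite /even_at /odd_at gen_at_tail. Qed.

Lemma colour_at_tail s l p : 12 <= l -> 2 <= p ->
  colour_at s l p = tail_colour (core s) (total_zeros s) (zeros s l).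
Proof.
move=> l12 p2; have [h1 h2] : (l < 12) = false /\ (p < 2) = false by lia.
by rewrite /colour_at h1 h2.
Qed.

Lemma zeros_lt_total s c : 12 <= c -> ~~ s c -> zeros s c < total_zeros s.
Proof.
move=> c12 s_c; have := zeros_mono s (ltn_ord c).
by rewrite zerosS // bitE s_c addn1 -/(total_zeros s).
Qed.

Lemma surgery_tail s c X e : 1 < total_zeros s -> circle_constant s X -> 12 <= c -> ~~ s c ->
  surgery gen_ok s c X (mk_state (flip s c) e).2 =
  tail_rule (core s) (core_labels X) (label_of s X) e (total_zeros s) (zeros s c).
Proof.
move=> m_gt1 cX c12 s_c; have m_gt0 := ltnW m_gt1; have cN := ltn_ord c.
have mE := total_zeros_flip_tail c12 s_c.
have m_gt0' : 0 < total_zeros (flip s c) by lia.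
have zE l := zeros_flip_tail l c12 s_c.
rewrite surgery_colour //; have [-> ->] := even_at_tail c12.
rewrite !ffunE !colour_nd ?(ltnW cN) //.
have c12' : 12 <= c.+1 by lia.
rewrite !colour_at_tail // core_flip_tail // zerosS // bitE s_c addn1.
have jm := zeros_lt_total c12 s_c.
have z1 : zeros (flip s c) c = zeros s c by rewrite (zE c) ltnn addn0.
have z2 : zeros (flip s c) c.+1 = zeros s c by have := zE c.+1; rewrite zerosS // bitE s_c ltnSn; lia.
rewrite z1 z2; have mE' : total_zeros (flip s c) = (total_zeros s).-1 by rewrite mE.
rewrite mE' /tail_rule [in RHS]andbA.
set j := zeros s c in z1 z2 jm *; set b := core s; set m := total_zeros s in mE mE' m_gt1 m_gt0 jm *.
congr (_ && _).
(* A small circle away from the surgery stays small, possibly with its number lowered by one, so the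
   target labels it [v_-]. *)
have far l : l <= N -> 12 <= l -> 0 < zeros s l < m -> zeros s l != j -> zeros s l != j.+1 ->
    0 < zeros (flip s c) l < m.-1.
  move=> lN l12 zl n1 n2; have := zE l; case: (ltnP c l) => cl.
    by have := zeros_mono s cl; rewrite zerosS // bitE s_c; lia.
  by have := zeros_mono s cl; lia.
apply/forallP/andP => [h|[/allP h1 /allP h2] x].
  split; [apply/allP=> i | apply/allP=> t]; rewrite mem_iota => hi.
    have := h (core_node i); rewrite ffunE !colour_core_node // core_flip_tail //.
    by rewrite (label_ofE _ m_gt0 cX) colour_core_node // (nth_core_labels m_gt0 cX).
  have ht : 0 < t < m by lia.
  have [l [hl zl cl]] := small_node ht; have [lN l12] : l <= N /\ 12 <= l by lia.
  have [//|n1] := eqVneq t j.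
  have [//|n2] := eqVneq t j.+1.
  have := h (nd l 2); rewrite ffunE (label_ofE _ m_gt0 cX) cl colour_nd // colour_at_tail //.
  have {}far := far l lN l12; rewrite zl in far; have {}far := far ht n1 n2.
  rewrite mE' (tail_colour_small _ far) label_small; last lia.
  have TE t' : t' <= m -> t != t' -> (51 + t == tail_colour b m t') = false.
    move=> t'm ne; rewrite /tail_colour; have lt50 := rep_lt b (isT : 50 < 52).
    have lt2 := rep_lt b (isT : 2 < 52); have [_|n0] := eqVneq t' 0; first lia.
    by case: (eqVneq t' m) => ?; lia.
  by rewrite !TE // ?(ltnW jm) //; case: (label_of _ _ _).
have hi i : i < 52 -> colour s x = rep b i -> colour (flip s c) x = rep b i ->
    [|| colour s x == tail_colour b m j, colour s x == tail_colour b m j.+1 |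
        (mk_state (flip s c) e).2 x == X x].
  move=> i52 e1 e2; rewrite ffunE (label_ofE _ m_gt0 cX) e1 e2.
  by have := h1 i; rewrite mem_iota i52 (nth_core_labels m_gt0 cX) // => /(_ isT).
have [[i i52 ex]|[l hl [p p4 ex]]] := node_cases x.
  by apply: (hi i) => //; rewrite ex colour_core_node // core_flip_tail.
have [lN l12] : l <= N /\ 12 <= l by lia.
have E t : 0 < total_zeros t -> colour t x = colour_at t l p by move=> ?; rewrite ex colour_nd.
case: (ltnP p 2) => p2.
  have l12' : (l < 12) = false by lia.
  by apply: (hi p); rewrite ?E ?/colour_at ?l12' ?p2 ?core_flip_tail //; lia.
have E1 := E _ m_gt0; have E2 := E _ m_gt0'.
rewrite !colour_at_tail // in E1 E2; rewrite core_flip_tail // mE' in E2.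
have zl := zE l; have zlm := zeros_mono s lN; rewrite -/(total_zeros s) -/m in zlm.
have [z0|z0] := eqVneq (zeros s l) 0.
  apply: (hi 50); rewrite ?E1 ?E2 ?z0 //.
  by rewrite (_ : zeros (flip s c) l = 0) //; lia.
have [zm|zm] := eqVneq (zeros s l) m.
  apply: (hi 2); rewrite ?E1 ?E2 ?zm ?tail_colour_max //.
  rewrite (_ : zeros (flip s c) l = m.-1) ?tail_colour_max //; first lia.
  case: (ltnP c l) zl => cl; first by lia.
  by have := zeros_mono s cl; lia.
have zlt : 0 < zeros s l < m by lia.
rewrite (tail_colour_small _ zlt) in E1; rewrite E1 ffunE (label_ofE _ m_gt0 cX) E1 E2.
have [n1|n1] := eqVneq (zeros s l) j.
  by rewrite -n1 tail_colour_small ?eqxx.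
have [n2|n2] := eqVneq (zeros s l) j.+1.
  by rewrite -n2 (tail_colour_small _ zlt) eqxx orbT.
have := h2 (zeros s l); rewrite mem_iota (negbTE n1) (negbTE n2) /= => h3.
have {}h3 : ~~ label_of s X (51 + zeros s l) by apply: h3; lia.
have {}far := far l lN l12 zlt n1 n2.
rewrite (tail_colour_small _ far) label_small; last lia.
by rewrite (negbTE h3) !orbT.
Qed.

(** With all core smoothings vertical, position 2 runs straight from level 0 to level 12. *)
Lemma reps_trivial : rep (nseq 12 false) 50 = rep (nseq 12 false) 2.
Proof. by vm_compute. Qed.

(* Straightening the only horizontal smoothing splits the circle of the two
   rightmost strands. *)
Lemma surgery_last s c X e : total_zeros s = 1 -> circle_constant s X -> 12 <= c -> ~~ s c ->
  core s = nseq 12 false -> e.2 = [::] ->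
  surgery gen_ok s c X (mk_state (flip s c) e).2 = all negb (core_labels X).
Proof.
move=> m1 cX c12 s_c coreE e2; have m_gt0 : 0 < total_zeros s by rewrite m1.
have lab a : label e a = false by rewrite /label e2 andbF.
rewrite surgery_colour //; have [-> ->] := even_at_tail c12.
have cN := ltn_ord c; have c12' : 12 <= c.+1 by lia.
have := zeros_lt_total c12 s_c; rewrite m1 ltnS leqn0 => /eqP z0.
have z1 : zeros s c.+1 = 1 by rewrite zerosS // bitE s_c z0.
have q : rep (core s) 50 = rep (core s) 2 by rewrite coreE reps_trivial.
rewrite !ffunE !lab !colour_at_tail // z0 z1 m1 tail_colour0 tail_colour_max // q; cbv zeta; rewrite eqxx.
have -> a : surgery_rule (~~ true) a a false false = ~~ a by case: a.
apply/andP/allP => [[/forallP h1 h2] a /mapP[i i52 ->]|h].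
  rewrite mem_iota in i52; have := h1 (core_node i).
  rewrite ffunE lab (label_ofE _ m_gt0 cX) colour_core_node //.
  by case: eqP => [->|_] //=; case: (label_of _ _ _).
have fl i : i < 52 -> label_of s X (rep (core s) i) = false.
  move=> i52; rewrite -(nth_core_labels m_gt0 cX) //; apply/negbTE; apply: h.
  by rewrite mem_nth // size_map size_iota.
split; last by rewrite fl.
apply/forallP=> x; rewrite ffunE lab (label_ofE _ m_gt0 cX).
have [[i [i52 -> _]]|[l [_ zl _ _]]] := colour_cases x m_gt0; last by rewrite m1 in zl; lia.
by rewrite fl // !orbT.
Qed.

(** * The cochain, its closedness and its value on psi *)

Definition compatible s (e : entry) : bool :=
  (core s == e.1) && (total_zeros s == count id e.1).

(** Equality of counts in [compatible] means that exactly [k] crossings are in the 1-resolution, as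
    in the oriented resolution, so the cochain sits in homological degree 0. *)
Definition cocycle (y : state 4 (beta k)) : bool :=
  \big[addb/false]_(e <- cert) (compatible y.1 e && (y == mk_state y.1 e)).

Lemma mk_state_valid s e : e \in cert -> compatible s e -> valid (mk_state s e).
Proof.
move=> /(allP cert_check)/and3P[_ /implyP h _] /andP[_ /eqP m]; apply/validP=> x y /= xy.
rewrite !ffunE; have [m0|m_gt0] := posnP (total_zeros s).
  by rewrite /label (eqP (h _)) ?andbF //; rewrite -m m0.
by have := connect_colour x y m_gt0; rewrite xy => /esym/eqP->.
Qed.

(** A crossing and an entry determine the target completely: the resolution is the flip, and the
    labels come from the entry through the colours. *)
Lemma cocycle_sum (x : state 4 (beta k)) : valid x ->
  \big[addb/false]_(y | valid y) (dcoef x y && cocycle y) =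
  \big[addb/false]_(c | ~~ x.1 c) \big[addb/false]_(e <- cert)
    (compatible (flip x.1 c) e && surgery gen_ok x.1 c x.2 (mk_state (flip x.1 c) e).2).
Proof.
move=> vx; rewrite exchange_big /=.
transitivity (\big[addb/false]_(e <- cert) \big[addb/false]_(y : state 4 (beta k) | y == mk_state y.1 e)
   [&& valid y, compatible y.1 e & dcoef x y]).
  rewrite (eq_bigr (fun y => \big[addb/false]_(e <- cert)
     (dcoef x y && (compatible y.1 e && (y == mk_state y.1 e))))); last first.
    by move=> y _; rewrite big_distrr.
  rewrite exchange_big; apply: eq_bigr => e _.
  rewrite big_mkcond [RHS]big_mkcond; apply: eq_bigr => y _ /=.
  by case: (valid y); case: (dcoef x y); case: (compatible _ _); case: (_ == _).
apply: eq_big_seq => e e_cert.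
rewrite (reindex_onto (fun t => mk_state t e) (fun y : state 4 (beta k) => y.1)) => [|y /eqP <- //].
transitivity (\big[addb/false]_(t : resolution) \big[addb/false]_(c | ~~ x.1 c)
    ((t == flip x.1 c) && (compatible (flip x.1 c) e &&
       surgery gen_ok x.1 c x.2 (mk_state (flip x.1 c) e).2))).
  apply: eq_big => [t|t _] /=; first by rewrite !eqxx.
  case: (boolP (compatible t e)) => ce; last first.
    rewrite andbF big1 // => c _; case: eqP => //= te.
    by rewrite -te (negbTE ce).
  rewrite mk_state_valid //= (dcoef_surgery gen_ok) ?mk_state_valid //.
  apply: eq_bigr => c _ /=; case: eqP => //= te.
  by rewrite -te ce.
rewrite exchange_big; apply: eq_bigr => c _.
rewrite (bigD1 (flip x.1 c)) //= eqxx big1 ?addbF // => t /negbTE ->.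
by [].
Qed.

Lemma count_core_flip s c : c < 12 -> ~~ s c ->
  count id (core (flip s c)) = (count id (core s)).+1.
Proof.
move=> c12 s_c; have c_in : val c \in iota 0 12 by rewrite mem_iota.
rewrite !count_map -!sum1_count ![\sum_(i <- _ | _) _]big_mkcond.
rewrite !(bigD1_seq _ c_in (iota_uniq 0 12)) /= bit_flip eqxx bitE s_c (negbTE s_c) /= add1n add0n.
by congr _.+1; apply: eq_bigr => i /negbTE ne; rewrite bit_flip ne.
Qed.

(** Flipping a positive crossing raises the count of 1-resolutions in the core by one; flipping a
    negative one lowers [m] by one. Either way the source has [m] one above the count. *)
Lemma compatible_core s c e : e \in cert -> ~~ s c -> compatible (flip s c) e ->
  (total_zeros s == (count id (core s)).+1) && (core s \in patterns).
Proof.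
move=> /(allP cert_check)/and3P[e_pat _ /allP e_clear] s_c /andP[/eqP e1 /eqP e2].
case: (ltnP c 12) => c12.
  rewrite -(count_core_flip c12 s_c) e1 -e2 total_zeros_flip // eqxx /=.
  suff -> : core s = set_nth false e.1 c false by apply: e_clear; rewrite mem_iota.
  apply: (@eq_from_nth _ false).
    by rewrite -e1 size_set_nth !size_mkseq; apply/esym/maxn_idPr.
  move=> i; rewrite size_mkseq => i12; rewrite nth_set_nth /= -e1 !nth_core // bit_flip.
  by case: eqP => // ->; rewrite bitE (negbTE s_c).
rewrite core_flip_tail // in e1.
by rewrite (total_zeros_flip_tail c12 s_c) e2 e1 eqxx.
Qed.

(** Successive horizontal smoothings see the counts 0, 1, 2 and so on. The sum thus depends only on
    how many there are, not on where they lie. *)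
Lemma zeros_sum s (f : nat -> bool) l : 12 <= l ->
  \big[addb/false]_(12 <= i < l | ~~ bit s i) f (zeros s i) =
  \big[addb/false]_(0 <= j < zeros s l) f j.
Proof.
elim: l => // l IHl; rewrite leq_eqVlt => /predU1P[<-|l12].
  by rewrite zeros_le12 // !big_geq.
rewrite zerosS // big_mkcond big_nat_recr //= -big_mkcond IHl //.
by case: (bit s l); rewrite /= ?addn0 ?addbF ?addn1 ?big_nat_recr.
Qed.

Lemma size_reps b : size (reps b) = 52.
Proof.
rewrite /reps /union_find; move: (core_edges b) => E.
have : size (iota 0 52) = 52 by [].
by elim: E (iota 0 52) => //= e E IHE r rE; apply: IHE; rewrite size_map.
Qed.

Lemma core_labels_reps s X : 0 < total_zeros s -> circle_constant s X ->
  core_labels X = [seq a \in [seq a <- undup (reps (core s)) | label_of s X a] | a <- reps (core s)].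
Proof.
move=> m_gt0 cX; apply: (@eq_from_nth _ false); rewrite !size_map ?size_iota ?size_reps // => i i52.
rewrite (nth_core_labels m_gt0 cX) // (nth_map 0) ?size_reps //.
by rewrite mem_filter mem_undup mem_nth ?size_reps ?andbT.
Qed.

Lemma cocycle_closed (x : state 4 (beta k)) : valid x ->
  \big[addb/false]_(y | valid y) (dcoef x y && cocycle y) = false.
Proof.
case: x => s X vx; have /validP/= cX := vx; rewrite cocycle_sum //=.
(* If these conditions fail, no target lies in the support of the cochain. *)
case: (boolP ((total_zeros s == (count id (core s)).+1) && (core s \in patterns))); last first.
  move=> bad; rewrite big1 // => c s_c; rewrite big1_seq // => e /andP[_ e_cert].
  apply/negbTE; apply: contra bad => /andP[h _]; exact: compatible_core h.
case/andP=> /eqP mE b_pat; have m_gt0 : 0 < total_zeros s by rewrite mE.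
set b := core s in mE b_pat; set m := total_zeros s in mE m_gt0.
set fl := core_labels X; pose F := label_of s X; pose r := reps b; pose rs := flipped_reps b.
pose np := no_small_plus F m.
have flE i : i < 52 -> nth false fl i = F (rep b i) by exact: nth_core_labels.
pose P l := xor_sum (fun e : entry => if e.1 == set_nth false b l true
   then core_rule r (nth [::] rs l) l fl e else false) cert.
pose tau j := \big[addb/false]_(e <- cert) ((e.1 == b) &&
   (if count id b == 0 then all negb fl else tail_rule b fl F e m j)).
pose f l := if l < 12 then np && P l else tau (zeros s l).
transitivity (\big[addb/false]_(0 <= l < N | ~~ bit s l) f l).
  rewrite big_mkord; apply: eq_big => [c|c s_c]; first by rewrite bitE.
  rewrite /f; case: ltnP => c12.
    rewrite /P xor_sumE big_distrr /=; apply: eq_big_seq => e e_cert.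
    rewrite /compatible core_flip // -/b eq_sym; case: eqP => [eE|]; last by rewrite andbF.
    rewrite total_zeros_flip // eE -/b -core_flip // count_core_flip // -mE eqxx /=.
    rewrite surgery_core //; have /and3P[e_pat _ _] := allP cert_check _ e_cert.
    suff -> : nth [::] rs c = reps (set_nth false b c true) by [].
    by rewrite /rs (nth_map 0) ?size_iota // nth_iota // add0n; cbv zeta; rewrite -eE e_pat.
  apply: eq_big_seq => e e_cert.
  rewrite /compatible core_flip_tail // -/b eq_sym; case: eqP => [eE|//]; rewrite !andTb.
  have mE' := total_zeros_flip_tail c12 s_c.
  have -> : total_zeros (flip s c) = count id e.1 by rewrite eE; move: mE; rewrite /m mE' => -[].
  (* With no positive crossing in the 1-resolution [m] is 1 and the surgery is a split; otherwise it
     merges two regions of the tail. *)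
  rewrite eqxx andTb; case: eqP => b0; last first.
    have m_gt1 : 1 < total_zeros s by rewrite -/m mE ltnS lt0n; apply/eqP.
    exact: (surgery_tail e m_gt1 cX c12 s_c).
  have /and3P[_ /implyP e0 _] := allP cert_check _ e_cert.
  have m1 : total_zeros s = 1 by rewrite -/m mE b0.
  have {}e0 : e.2 = [::] by apply/eqP; apply: e0; rewrite eE b0.
  apply: (surgery_last m1 cX c12 s_c _ e0).
  apply: (@eq_from_nth _ false); rewrite ?size_mkseq // => i i12.
  rewrite nth_nseq if_same; apply/negbTE/negP => hi.
  have : has id b by apply/hasP; exists (nth false b i) => //; rewrite mem_nth // size_mkseq.
  by rewrite has_count b0.
have N12 : 12 <= N by rewrite size_beta.
rewrite (big_cat_nat (leq0n 12) N12).
have -> : \big[addb/false]_(0 <= l < 12 | ~~ bit s l) f l =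
    np && xor_sum (fun l => if nth false b l then false else P l) (iota 0 12).
  rewrite xor_sumE big_distrr big_mkcond /=; apply: eq_big_seq => l; rewrite mem_iota => hl.
  have l12 : l < 12 by [].
  by rewrite /f l12 nth_core //; case: (bit s l); rewrite ?andbF.
have -> : \big[addb/false]_(12 <= l < N | ~~ bit s l) f l =
    np && xor_sum (fun e : entry => if e.1 == b then
      if count id b == 0 then all negb fl
      else lowered_at r 50 fl e (+) lowered_at r 2 fl e else false) cert.
  transitivity (\big[addb/false]_(12 <= l < N | ~~ bit s l) tau (zeros s l)).
    rewrite big_mkcond [RHS]big_mkcond; apply: eq_big_nat => l /andP[l12 _].
    by rewrite /f ltnNge l12.
  rewrite zeros_sum -/(total_zeros s) -/m ?size_beta // exchange_big xor_sumE big_distrr.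
  apply: eq_bigr => e _; case: (e.1 == b); last by rewrite big1 // [RHS]andbF.
  case: eqP => b0; first by rewrite mE b0 big_nat1 /np mE b0.
  have m_gt1 : 1 < m by rewrite mE ltnS lt0n; apply/eqP.
  exact: (@tail_sum b fl F e flE m m_gt1).
(* The factor [np] common to core and tail splits off. What remains is [cocycle_defect], with the
   labelling encoded by its set of [v_+] circles, as in [cocycle_check]. *)
apply: (etrans (esym (andb_addr np _ _))); apply/negbTE; rewrite negb_and; apply/orP; right.
have /allP/(_ _ b_pat) := cocycle_check.
cbv zeta; move/allP/(_ _ (filter_subseqs F (undup r))).
by rewrite -core_labels_reps.
Qed.

Lemma cocycle_psi : cocycle ([ffun c => ~~ sgn c], [ffun=> false] : {ffun node -> bool}).
Proof.
set s := [ffun c => ~~ sgn c].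
have bitN l : l < N -> bit s l = (12 <= l).
  by move=> lN; rewrite -[l]/(val (Ordinal lN)) bitE ffunE sgn_beta -leqNgt.
have coreE : core s = nseq 12 false.
  apply: (@eq_from_nth _ false); rewrite size_mkseq // => i i12.
  by rewrite nth_core // nth_nseq if_same bitN ?size_beta; lia.
have m0 : total_zeros s = 0.
  apply/eqP; rewrite -leqn0 leqNgt -has_count; apply/hasPn => l; rewrite mem_iota => hl.
  by rewrite negbK bitN; lia.
(* Only entries with the all-[false] pattern are compatible here, and [cert] contains exactly
   one. *)
transitivity (xor_sum (fun e : entry => e.1 == nseq 12 false) cert); last by vm_compute.
rewrite xor_sumE; apply: eq_big_seq => e e_cert; rewrite /compatible /= coreE m0 eq_sym.
case: eqP => //= eE; rewrite eE eqxx /=.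
have /and3P[_ /implyP e0 _] := allP cert_check _ e_cert.
apply/eqP; congr (_, _); apply/ffunP=> x; rewrite !ffunE.
by rewrite /label (eqP (e0 _)) ?andbF // eE.
Qed.

End Cocycle.

Theorem theorem5p1 : forall (k : nat) (mk : 'I_(size (beta k)) * 'I_4),
  psi_red_nonzero mk.
Proof.
move=> k mk; split; first exact: (psi_cycle (@gen_beta_lt k)).
exact: (psi_not_boundary (@gen_beta_lt k) (@cocycle_closed k) (cocycle_psi k)).
Qed.
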